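(* Let $d\in\mathbb N$, $1\le p<\infty$, $1\le v<\infty$, and let $Y_1,Y_2,\dots$ be i.i.d. with law $P_0\in\mathcal P_d$. Suppose $$k_n=\begin{cases} n^{1/(2v)} & d\le 2v,\\ n^{1/d} & d>2v,\end{cases}$$ and let $K_n=\lceil \log_2 k_n\rceil$, $b_n=2^{K_n}$. Suppose the prior concentrations satisfy $\alpha_{\mathbf j,b_n}\ge 0$ for all $n$ and all $\mathbf j\in[b_n]^d$, and that there is a constant $A>0$ (not depending on $n$) such that for all $n$ $$\sum_{\mathbf j\in[b_n]^d}\alpha_{\mathbf j,b_n}\le \begin{cases} A\,n^{1/2} & d\le 2v,\\ A\,n^{1-v/d} & d>2v.\end{cases}$$ Then there exist constants $C>0$ and $N\in\mathbb N$ not depending on $n$ such that for all $n\ge N$, $$\mathbb E_{P_0} W_v(P_0,\bar P_n)\le \begin{cases} C\,n^{-1/(2v)} & d<2v,\\ C\,n^{-1/(2v)}\log^{1/v}(n) & d=2v,\\ C\,n^{-1/d} & d>2v,\end{cases}$$ where the expectation is over $Y_1,\dots,Y_n$.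
   Context: The space is $[0,1)^d$ with metric $\|x-y\|_p=(\sum_{i=1}^d|x_i-y_i|^p)^{1/p}$; $\mathcal P_d$ denotes the set of Borel probability measures on $[0,1)^d$. For $\mu,\nu\in\mathcal P_d$, $W_v(\mu,\nu)=\big(\inf_{\pi}\int\|x-y\|_p^v\,d\pi(x,y)\big)^{1/v}$, the infimum over couplings $\pi$ of $\mu$ and $\nu$. For $b\in\mathbb N$ write $[b]=\{1,\dots,b\}$ and, for a multi-index $\mathbf i=(i_1,\dots,i_d)\in[b]^d$, $A_{\mathbf i,b}=\prod_{l=1}^d\big[\tfrac{i_l-1}{b},\tfrac{i_l}{b}\big)$ (these cells partition $[0,1)^d$). For a weight vector $\boldsymbol\pi=(\pi_{\mathbf i})_{\mathbf i\in[b]^d}$ with $\pi_{\mathbf i}\ge0$, $\sum\pi_{\mathbf i}=1$, the histogram measure $\psi_b(\boldsymbol\pi)=\mathrm{Histogram}(\cdot\mid\boldsymbol\pi,b)$ is the probability measure with Lebesgue density $\sum_{\mathbf i\in[b]^d} b^d\pi_{\mathbf i}\mathbb I(y\in A_{\mathbf i,b})$. Given prior concentrations $\alpha_{\mathbf i,b_n}\ge0$, the posterior concentrations are $\alpha^*_{\mathbf i,b_n}=\alpha_{\mathbf i,b_n}+\sum_{t=1}^n\mathbb I(Y_t\in A_{\mathbf i,b_n})$, and the (posterior mean) histogram estimator is $\bar P_n=\psi_{b_n}\big((\alpha^*_{\mathbf i,b_n}/\sum_{\mathbf j\in[b_n]^d}\alpha^*_{\mathbf j,b_n})_{\mathbf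 i\in[b_n]^d}\big)$. *)

(* Defs.v *)
From HB Require Import structures.
From mathcomp Require Import all_boot all_order all_algebra.
From mathcomp Require Import all_classical all_reals all_analysis.

Set Implicit Arguments.
Unset Strict Implicit.
Unset Printing Implicit Defensive.

Import Order.TTheory GRing.Theory Num.Theory.
Import numFieldNormedType.Exports.

Local Open Scope classical_set_scope.
Local Open Scope ring_scope.

Section Wasserstein_histogram.
Variable R : realType.

(* Points of R^d are d-tuples of reals, with the product (Borel) sigma-algebra
   provided by MathComp-Analysis (measure_tuple_display). *)

Definition unit_cube (d : nat) : set (d.-tuple R) :=
  [set y | forall l : 'I_d, 0 <= tnth y l < 1].

(* P_d : Borel probability measures on [0,1)^d, seen as probability measures
   on R^d giving full mass to [0,1)^d. *)
Definition in_Pd (d : nat) (mu : probability (d.-tuple R) R) : Prop :=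
  mu (@unit_cube d) = 1%E.

Definition pdist (d : nat) (p : R) (x y : d.-tuple R) : R :=
  (\sum_(l < d) `|tnth x l - tnth y l| `^ p) `^ p^-1.

Definition coupling (d : nat) (mu nu : set (d.-tuple R) -> \bar R)
  (pi : probability (d.-tuple R * d.-tuple R)%type R) : Prop :=
  forall A : set (d.-tuple R), measurable A ->
    pi (A `*` setT) = mu A /\ pi (setT `*` A) = nu A.

Definition wasserstein (d : nat) (p v : R)
  (mu nu : set (d.-tuple R) -> \bar R) : \bar R :=
  ((ereal_inf [set (\int[pi]_z ((pdist p z.1 z.2) `^ v)%:E)%E
               | pi in coupling mu nu]) `^ v^-1)%E.

(* Iterated Lebesgue integral over R^d (equal, by Tonelli, to the integral
   against d-dimensional Lebesgue measure for nonnegative measurable f). *)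
Fixpoint lebesgue_iter (n : nat) : (n.-tuple R -> \bar R) -> \bar R :=
  match n with
  | 0 => fun f => f [tuple]
  | m.+1 => fun f =>
      (\int[@lebesgue_measure R]_(x in [set: R])
          lebesgue_iter (fun t : m.-tuple R => f (cons_tuple x t)))%E
  end.

(* Cells A_{i,b} = prod_l [(i_l-1)/b, i_l/b), indexed here by
   i : {ffun 'I_d -> 'I_b}, i.e. i_l - 1 in {0,...,b-1}. *)
Definition cell (d b : nat) (i : {ffun 'I_d -> 'I_b}) : set (d.-tuple R) :=
  [set y | forall l : 'I_d,
     (i l)%:R / b%:R <= tnth y l < (i l).+1%:R / b%:R].

Definition hist_density (d b : nat) (w : {ffun 'I_d -> 'I_b} -> R)
  (y : d.-tuple R) : R :=
  \sum_(i : {ffun 'I_d -> 'I_b}) (b%:R ^+ d * w i * \1_(cell i) y).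

Definition histogram (d b : nat) (w : {ffun 'I_d -> 'I_b} -> R)
  : set (d.-tuple R) -> \bar R :=
  fun B => lebesgue_iter (fun y : d.-tuple R =>
                            (\1_B y * hist_density w y)%:E).

Definition k_seq (d : nat) (v : R) (n : nat) : R :=
  if d%:R <= 2 * v then n%:R `^ (2 * v)^-1 else n%:R `^ (d%:R)^-1.

Definition K_seq (d : nat) (v : R) (n : nat) : nat :=
  `|Num.ceil (ln (k_seq d v n) / ln 2)|%N.

Definition b_seq (d : nat) (v : R) (n : nat) : nat := (2 ^ K_seq d v n)%N.

Definition post_conc (d b : nat) (alpha : {ffun 'I_d -> 'I_b} -> R)
  (ys : nat -> d.-tuple R) (n : nat) (i : {ffun 'I_d -> 'I_b}) : R :=
  alpha i + \sum_(t < n) \1_(cell i) (ys t).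

Definition hist_estimator (d b : nat) (alpha : {ffun 'I_d -> 'I_b} -> R)
  (ys : nat -> d.-tuple R) (n : nat) : set (d.-tuple R) -> \bar R :=
  histogram (fun i => post_conc alpha ys n i /
                      \sum_(j : {ffun 'I_d -> 'I_b}) post_conc alpha ys n j).

Definition iid_with_law {dO : measure_display} {Omega : measurableType dO}
  (P : probability Omega R) (d : nat) (Y : nat -> Omega -> d.-tuple R)
  (P0 : probability (d.-tuple R) R) : Prop :=
  [/\ (forall t, measurable_fun setT (Y t)),
      (forall t (A : set (d.-tuple R)), measurable A ->
         P (Y t @^-1` A) = P0 A) &
      (forall (s : seq nat) (A : nat -> set (d.-tuple R)), uniq s ->
         (forall t, measurable (A t)) ->
         P (\big[setI/setT]_(t <- s) (Y t @^-1` A t)) =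
         (\prod_(t <- s) P (Y t @^-1` A t))%E)].

End Wasserstein_histogram.

(* Main.v *)
Require Import Defs.
From HB Require Import structures.
From mathcomp Require Import all_boot all_order all_algebra.
From mathcomp Require Import all_classical all_reals all_analysis.
From mathcomp Require Import measurable_realfun ring lra.

(** Transport along the dyadic tree of cells: match the masses of [P_0] and of
    the histogram greedily, first inside the leaves (side [2^-K]), then inside
    their ancestors of side [2^-(K-1)], and so on.  After level [k] the mass
    still unmatched is at most the sum over the cells [c] of that level of
    [|P_0(c) - \bar P_n(c)|], and it travels at most [d^(1/p) 2^-(k-1)]
    afterwards.  Hence [W_v^v] is bounded by [2^(-Kv)] plus the sum over [k] of
    [2^(-kv)] times these total variations, which consist of a prior part
    [2 S / n], with [S] the total prior concentration, and of a multinomial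
    deviation of expected size [sqrt (2^(kd) / n)].  The tangent inequality
    [x^(1/v) <= B^(1/v) (1 + x / B)] replaces Jensen's inequality; since the
    final bound is an explicit measurable function of the sample, the
    measurability of [W_v] as a function of the sample is never needed. *)

Set Implicit Arguments.
Unset Strict Implicit.
Unset Printing Implicit Defensive.

Import Order.TTheory GRing.Theory Num.Theory.
Import numFieldNormedType.Exports.

Local Open Scope classical_set_scope.
Local Open Scope ring_scope.

(** * Greedy coupling on a tree of partitions *)

Section tree_coupling.
Context {R : realFieldType} {I : finType}.

Lemma sum_fiber (T : finType) (f : I -> T) (F : I -> R) :
  \sum_i F i = \sum_c \sum_(i | f i == c) F i.
Proof. by rewrite (partition_big f xpredT). Qed.

(** Inside a fiber of masses [s a] and [s w], put [a i * w j / max (s a) (s w)] on each pair. Row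
    [i] then sums to [a i] times the fraction [s w / max (s a) (s w) <= 1], and symmetrically for
    columns, so the fiber leaves exactly the positive part of [s a - s w] unmatched. A fiber without
    mass has maximum 0, and the convention [0^-1 = 0] gives it the zero plan. *)
Lemma match_fibers (T : finType) (f : I -> T) (a w : I -> R) :
  (forall i, 0 <= a i) -> (forall i, 0 <= w i) ->
  exists g : I -> I -> R, [/\ forall i j, 0 <= g i j,
    forall i j, f i != f j -> g i j = 0,
    forall i, \sum_j g i j <= a i,
    forall j, \sum_i g i j <= w j &
    \sum_i (a i - \sum_j g i j) <=
      \sum_c `|\sum_(i | f i == c) a i - \sum_(i | f i == c) w i|].
Proof.
move=> a0 w0.
pose s (u : I -> R) c := \sum_(i | f i == c) u i.
pose M c := Num.max (s a c) (s w c).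
have s0 u c : (forall i, 0 <= u i) -> 0 <= s u c by move=> u0; apply: sumr_ge0.
have M0 c : 0 <= M c by rewrite le_max s0.
pose g i j := if f i == f j then a i * w j / M (f i) else 0.
have row i : \sum_j g i j = a i * (s w (f i) / M (f i)).
  rewrite -big_mkcond /= mulrA /s mulr_sumr mulr_suml.
  by apply: eq_bigl => j; rewrite eq_sym.
have col j : \sum_i g i j = w j * (s a (f j) / M (f j)).
  rewrite -big_mkcond /= mulrA /s mulr_sumr mulr_suml.
  by apply: eq_bigr => i /eqP ->; rewrite [w j * _]mulrC.
have frac c : s a c / M c <= 1 /\ s w c / M c <= 1.
  have [->|Mn0] := eqVneq (M c) 0; first by rewrite invr0 !mulr0.
  by rewrite !ler_pdivrMr ?lt_def ?Mn0 ?M0// !mul1r /M !le_max !lexx orbT.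
exists g; split.
- by move=> i j; rewrite /g; case: ifP => // _; rewrite divr_ge0 ?mulr_ge0.
- by move=> i j; rewrite /g => /negbTE ->.
- by move=> i; rewrite row ler_piMr//; case: (frac (f i)).
- by move=> j; rewrite col ler_piMr//; case: (frac (f j)).
rewrite (sum_fiber f); apply: ler_sum => c _.
rewrite (eq_bigr (fun i => a i * (1 - s w c / M c))); last first.
  by move=> i /eqP <-; rewrite row mulrBr mulr1.
rewrite -mulr_suml -/(s a c) -/(s w c) /M.
have [saw|saw] := lerP (s a c) (s w c).
  apply: (@le_trans _ _ 0); last by rewrite subr_ge0.
  have [w00|wn0] := eqVneq (s w c) 0; last by rewrite divff// subrr mulr0.
  have -> : s a c = 0 by apply/le_anti; rewrite s0// andbT -w00.
  by rewrite mul0r.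
rewrite mulrBr mulr1 mulrCA divff ?mulr1 ?ler_norm//.
by rewrite gt_eqF// (le_lt_trans _ saw)// s0.
Qed.

(** The key quantity at a level [m] is the mass sent across distinct cells of level [m] plus the
    mass still unmatched. It is at most the total variation of level [m] once that level has been
    treated, and matching at coarser levels never increases it. *)
Lemma tree_coupling (T : nat -> finType) (f : forall k, I -> T k) (K : nat)
    (a w : I -> R) :
  (forall k i j, f k.+1 i = f k.+1 j -> f k i = f k j) ->
  (forall i j, f 0%N i = f 0%N j) ->
  (forall i, 0 <= a i) -> (forall i, 0 <= w i) ->
  \sum_i a i = \sum_i w i ->
  exists g : I -> I -> R, [/\ forall i j, 0 <= g i j,
    forall i, \sum_j g i j = a i,
    forall j, \sum_i g i j = w j &
    forall k, (k <= K)%N -> \sum_i \sum_j g i j * (f k i != f k j)%:R <=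
      \sum_c `|\sum_(i | f k i == c) a i - \sum_(i | f k i == c) w i|].
Proof.
move=> f_refine f0 a0 w0 aw.
pose TV k := \sum_c `|\sum_(i | f k i == c) a i - \sum_(i | f k i == c) w i|.
(* Induction from the leaves to the root: [k] is the level treated last, and [k = K.+1] stands for
   the empty plan, whose last clause ranges over no level. The plan [g] only moves mass inside cells
   of level [k]. *)
have partial n k : (n + k = K.+1)%N -> exists g : I -> I -> R,
    [/\ forall i j, 0 <= g i j,
    forall i j, f k i != f k j -> g i j = 0,
    forall i, \sum_j g i j <= a i,
    forall j, \sum_i g i j <= w j &
    forall m, (k <= m <= K)%N ->
      \sum_i \sum_j g i j * (f m i != f m j)%:R +
      \sum_i (a i - \sum_j g i j) <= TV m].
  elim: n k => [k0 k0E|n IHn k nk]; first (move: k0E; rewrite add0n => ->).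
    exists (fun=> fun=> 0); split=> // [i|j|m /andP[Km mK]].
    - by rewrite big1.
    - by rewrite big1.
    - by move: (leq_trans Km mK); rewrite ltnn.
  have [|g [g0 gf ga gw gTV]] := IHn k.+1; first by rewrite -nk addSn addnS.
  pose a' i := a i - \sum_j g i j; pose w' j := w j - \sum_i g i j.
  have gfk i j : f k i != f k j -> g i j = 0.
    by move=> ij; apply: gf; apply: contra_neq ij; exact: f_refine.
  have a'0 i : 0 <= a' i by rewrite subr_ge0.
  have w'0 i : 0 <= w' i by rewrite subr_ge0.
  have [h [h0 hf ha hw hTV]] := match_fibers (f k) a'0 w'0.
  exists (fun i j => g i j + h i j); split.
  - by move=> i j; rewrite addr_ge0.
  - by move=> i j fij; rewrite gfk ?hf ?addr0.
  - by move=> i; rewrite big_split /= -lerBrDl; exact: ha.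
  - by move=> i; rewrite big_split /= -lerBrDl; exact: hw.
  move=> m /andP[]; rewrite leq_eqVlt => /orP[/eqP <- _|km mK].
    (* At the new level [k] no mass crosses cells, so only the unmatched mass remains to be
       bounded. *)
    rewrite big1 ?add0r; last first.
      move=> i _; rewrite big1// => j _; case: eqP => [_|/eqP fij].
        by rewrite mulr0.
      by rewrite gfk ?hf ?addr0 ?mul0r.
    rewrite (eq_bigr (fun i => a' i - \sum_j h i j)); last first.
      by move=> i _; rewrite big_split opprD addrA.
    apply: (le_trans hTV); rewrite le_eqVlt; apply/orP; left; apply/eqP.
    apply: eq_bigr => c _; congr `|_|; rewrite !sumrB.
    (* Inside a cell of level [k] the earlier plan [g] removes the same mass from [a] and from [w];
       hence the residuals have the same discrepancy on the cell as the original weights. *)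
    suff -> : \sum_(i | f k i == c) \sum_j g i j =
              \sum_(j | f k j == c) \sum_i g i j by ring.
    rewrite exchange_big/= [RHS]big_mkcond; apply: eq_bigr => j _.
    rewrite big_mkcond; case: ifPn => jc; last first.
      rewrite big1// => i _; case: ifPn => // /eqP ic; apply: gfk.
      by rewrite ic eq_sym.
    apply: eq_bigr => i _; case: ifPn => // ic; apply/esym/gfk.
    by rewrite (eqP jc).
  apply: le_trans (gTV m _); last by rewrite km.
  rewrite -subr_ge0 -/(a' _).
  have -> : \sum_i (a i - \sum_j (g i j + h i j)) =
     \sum_i a' i - \sum_i \sum_j h i j.
    by rewrite -sumrB; apply: eq_bigr => i _; rewrite big_split opprD addrA.
  have -> : \sum_i \sum_j (g i j + h i j) * (f m i != f m j)%:R =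
     \sum_i \sum_j g i j * (f m i != f m j)%:R +
     \sum_i \sum_j h i j * (f m i != f m j)%:R.
    rewrite -big_split; apply: eq_bigr => i _ /=; rewrite -big_split.
    by apply: eq_bigr => j _ /=; rewrite mulrDl.
  (* At a finer level [m], the mass matched by [h] leaves the unmatched part and is counted at most
     once as crossing. *)
  have : \sum_i \sum_j h i j * (f m i != f m j)%:R <= \sum_i \sum_j h i j.
    apply: ler_sum => i _; apply: ler_sum => j _; rewrite ler_piMr//.
    by case: eqP.
  rewrite -/a'. lra.
have [g [g0 _ ga gw gTV]] := partial K.+1 0%N (addn0 _).
(* Level 0 has a single nonempty cell and the total masses agree, so nothing is left unmatched after
   it: the partial plan is a full coupling. *)
have TV0 : TV 0%N = 0.
  rewrite /TV big1// => c _; apply/eqP; rewrite normr_eq0 subr_eq0.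
  have [i0 /eqP ic|noc] := pickP (fun i => f 0%N i == c); last first.
    by rewrite !big_pred0.
  have all_c : (fun i => f 0%N i == c) =1 xpredT.
    by move=> i; apply/eqP; rewrite -ic; exact: f0.
  by rewrite !(eq_bigl _ _ all_c) aw.
have resa : \sum_i (a i - \sum_j g i j) = 0.
  apply/le_anti; rewrite sumr_ge0 ?andbT; last by move=> i _; rewrite subr_ge0.
  rewrite -[leRHS]TV0; apply: le_trans (gTV 0%N isT); rewrite lerDr.
  by apply: sumr_ge0 => i _; apply: sumr_ge0 => j _; rewrite mulr_ge0.
have resw : \sum_j (w j - \sum_i g i j) = 0.
  by move: resa; rewrite !sumrB [X in _ - X]exchange_big aw.
exists g; split=> //.
- move=> i; apply/esym/subr0_eq.
  exact: (psumr_eq0P (fun k _ => etrans (subr_ge0 _ _) (ga k)) resa).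
- move=> j; apply/esym/subr0_eq.
  exact: (psumr_eq0P (fun k _ => etrans (subr_ge0 _ _) (gw k)) resw).
move=> k kK; apply: le_trans (gTV k kK).
by rewrite lerDl sumr_ge0// => i _; rewrite subr_ge0.
Qed.

End tree_coupling.

(** * Integrals, densities and couplings of finite partitions *)

Section nonmeasurable_bound.
Local Open Scope ereal_scope.
Context d (T : measurableType d) (R : realType).
Variable mu : {measure set T -> \bar R}.

(** The integral of a nonnegative function is a supremum over the simple functions below it, which
    makes it monotone for arbitrary functions. *)
Lemma le_integral_nonmeasurable (f g : T -> \bar R) : (forall x, 0 <= f x) ->
  (forall x, f x <= g x) -> \int[mu]_x f x <= \int[mu]_x g x.
Proof.
move=> f0 fg; have g0 x : 0 <= g x by exact: le_trans (fg x).
rewrite !ge0_integralTE//; apply: le_ereal_sup => _ [h hf <-].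
by exists h => // x; exact: le_trans (hf x) (fg x).
Qed.

(** Adding [+oo] on the null set to [g] keeps its integral and turns the bound into one at every
    point. It is applied with [f] a transport cost, and with [f] the Wasserstein distance as a
    function of the sample. *)
Lemma le_integral_off_null (N : set T) (f g : T -> \bar R) :
  measurable N -> mu N = 0 -> measurable_fun setT g ->
  (forall x, 0 <= f x) -> (forall x, 0 <= g x) ->
  (forall x, ~ N x -> f x <= g x) -> \int[mu]_x f x <= \int[mu]_x g x.
Proof.
move=> mN N0 mg f0 g0 fg.
pose oo : T -> \bar R := cst +oo \_ N.
pose h x := g x + oo x.
have h0 x : 0 <= oo x.
  by rewrite /oo patchE; case: ifP => // _; rewrite leey.
have mh : measurable_fun setT oo.
  by apply/(measurable_restrictT _ mN); exact: measurable_cst.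
have -> : \int[mu]_x g x = \int[mu]_x h x.
  rewrite ge0_integralD// -[LHS]adde0; congr (_ + _).
  rewrite -integral_mkcond integral_cst//.
  by rewrite N0 mule0.
apply: le_integral_nonmeasurable => // x; rewrite /h /oo patchE; case: ifPn => xN.
  by rewrite addey ?leey// -ltNye (lt_le_trans _ (g0 x)).
by rewrite adde0; apply: fg; move: xN; rewrite notin_setE.
Qed.

End nonmeasurable_bound.

Section density.
Local Open Scope ereal_scope.
Context d (T : measurableType d) (R : realType).
Variables (mu : {measure set T -> \bar R}) (g : T -> \bar R).
Hypotheses (mg : measurable_fun setT g) (g0 : forall x, 0 <= g x)
  (g1 : \int[mu]_x g x = 1).

Let P (A : set T) := \int[mu]_(x in A) g x.

Let P0 : P set0 = 0.
Proof. by rewrite /P integral_set0. Qed.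

Let P_ge0 A : 0 <= P A.
Proof. exact: integral_ge0. Qed.

Let P_sigma_additive : semi_sigma_additive P.
Proof.
move=> F mF tF mUF; rewrite /P ge0_integral_bigcup//.
  by apply: is_cvg_nneseries => n _ _; exact: P_ge0.
exact: measurable_funTS.
Qed.

HB.instance Definition _ := isMeasure.Build _ _ _ P P0 P_ge0 P_sigma_additive.
HB.instance Definition _ := Measure_isProbability.Build _ _ _ P g1.

Lemma density_probability : exists nu : probability T R,
  forall A, nu A = \int[mu]_(x in A) g x.
Proof. by exists P. Qed.

End density.

Section finite_partition.
Local Open Scope ereal_scope.
Context d (T : measurableType d) (R : realType) (I : finType).

Lemma measure_finite_bigcup (mu : {measure set T -> \bar R}) (A : I -> set T) :
  (forall i, measurable (A i)) -> (forall i j x, A i x -> A j x -> i = j) ->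
  mu (\bigcup_i A i) = \sum_i mu (A i).
Proof.
move=> mA tA; rewrite measure_fin_bigcup//.
  rewrite (fsbigE (index_enum I)) ?index_enum_uniq//.
    by apply: eq_bigl => i; rewrite in_setT.
  by move=> i _; rewrite mem_index_enum.
  exact: finite_finset.
by move=> i j _ _ [x []]; exact: tA.
Qed.

(** The sets have total mass 1 but may leave part of [T] uncovered, as the cells do outside the
    cube; what they leave is null. *)
Lemma probability_partition (mu : probability T R) (A : I -> set T) X :
  (forall i, measurable (A i)) -> (forall i j x, A i x -> A j x -> i = j) ->
  \sum_i mu (A i) = 1 -> measurable X ->
  mu X = \sum_i mu (A i `&` X).
Proof.
move=> mA tA A1 mX.
have mU : measurable (\bigcup_i A i) by exact: fin_bigcup_measurable.
have U1 : mu (~` \bigcup_i A i) = 0.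
  by rewrite probability_setC// measure_finite_bigcup// A1 subee.
rewrite (measureDI mu mX mU) [X in X + _](_ : _ = 0) ?add0e.
  rewrite setI_bigcupr; under [RHS]eq_bigr => i _ do rewrite setIC.
  apply: measure_finite_bigcup => [i|i j x [_ Ai] [_]]; last exact: tA.
  exact: measurableI.
apply/eqP; rewrite eq_le measure_ge0 andbT -U1.
by apply: le_measure; rewrite ?inE//; [exact: measurableD|exact: measurableC].
Qed.

End finite_partition.

(** * Couplings with prescribed masses on rectangles *)

Section glue_coupling.
Local Open Scope ereal_scope.
Context d1 d2 (T1 : measurableType d1) (T2 : measurableType d2) (R : realType).
Variables (mu : probability T1 R) (nu : probability T2 R) (I J : finType).
Variables (A : I -> set T1) (B : J -> set T2) (a : I -> R) (b : J -> R).
Hypotheses (mA : forall i, measurable (A i)) (mB : forall i, measurable (B i))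
  (tA : forall i j x, A i x -> A j x -> i = j)
  (tB : forall i j x, B i x -> B j x -> i = j)
  (muA : forall i, mu (A i) = (a i)%:E) (nuB : forall i, nu (B i) = (b i)%:E).

(** Take the density [g i j / (a i * b j)] on [A i * B j] with respect to the product of [mu] and
    [nu]: given the pair of cells, the two points are independent, each following its conditional
    law. The row and column sums of [g] then give the marginals. *)
Lemma glue_coupling (g : I -> J -> R) :
  (forall i j, 0 <= g i j)%R ->
  (forall i, \sum_j g i j = a i)%R -> (forall j, \sum_i g i j = b j)%R ->
  (\sum_i a i = 1)%R -> (\sum_i b i = 1)%R ->
  exists pi : probability (T1 * T2)%type R, [/\
    forall X, measurable X -> pi (X `*` setT) = mu X,
    forall Y, measurable Y -> pi (setT `*` Y) = nu Y &
    forall i j, pi (A i `*` B j) = (g i j)%:E].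
Proof.
move=> g0 ga gb a1 b1.
have a0 i : (0 <= a i)%R by rewrite -ga sumr_ge0.
have b0 i : (0 <= b i)%R by rewrite -gb sumr_ge0.
(* If [a i * b j = 0], the quotient is 0; this loses no mass, because [g i j] is at most [a i] and
   at most [b j] and so vanishes too. *)
pose c i j := (g i j / (a i * b j))%R.
have c0 i j : (0 <= c i j)%R by rewrite divr_ge0// mulr_ge0.
have gab i j : (c i j * (a i * b j) = g i j)%R.
  have [ab0|ab0] := eqVneq (a i * b j)%R 0%R; last by rewrite /c divfK.
  rewrite ab0 mulr0; apply/esym/le_anti; rewrite g0 andbT.
  have /orP[/eqP <-|/eqP <-] : (a i == 0%R) || (b j == 0%R).
    by rewrite -mulf_eq0; apply/eqP.
    by rewrite -ga (bigD1 j)//= lerDl sumr_ge0.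
  by rewrite -gb (bigD1 i)//= lerDl sumr_ge0.
pose ind (q : I * J) (z : T1 * T2) :=
  (c q.1 q.2)%:E * (\1_(A q.1 `*` B q.2) z)%:E.
pose f z := \sum_q ind q z.
have mAB i j : measurable (A i `*` B j) by exact: measurableX.
have ind0 q z : 0 <= ind q z by rewrite mule_ge0// lee_fin.
have mind q D : measurable_fun D (ind q).
  apply: measurable_funTS; apply: emeasurable_funM => //.
  by apply/measurable_EFinP; apply: measurable_indic.
have mf : measurable_fun setT f by apply: emeasurable_sum.
have f0 z : 0 <= f z by apply: sume_ge0.
have int_rect X Y : measurable X -> measurable Y ->
    \int[mu \x nu]_(z in X `*` Y) f z =
    \sum_q (c q.1 q.2)%:E * (mu (A q.1 `&` X) * nu (B q.2 `&` Y)).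
  move=> mX mY; have mXY : measurable (X `*` Y) by exact: measurableX.
  rewrite ge0_integral_sum//; apply: eq_bigr => -[i j] _ /=.
  rewrite ge0_integralZl_EFin//=; last first.
    by apply: measurable_funTS; apply/measurable_EFinP; apply: measurable_indic.
  rewrite integral_indic// -setXI; congr (_ * _).
  by apply: product_measure1E; exact: measurableI.
have fine_le (d' : measure_display) (T' : measurableType d')
    (m : probability T' R) (D X : set T') (e : R) :
    measurable D -> measurable X -> m D = e%:E ->
    exists2 r, m (D `&` X) = r%:E & (0 <= r <= e)%R.
  move=> mD mX De; exists (fine (m (D `&` X))).
    by rewrite fineK// fin_num_measure//; exact: measurableI.
  rewrite fine_ge0// -lee_fin fineK; last first.
    by rewrite fin_num_measure//; exact: measurableI.
  by rewrite -De; apply: le_measure; rewrite ?inE//; exact: measurableI.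
have f1 : \int[mu \x nu]_z f z = 1.
  rewrite -setXTT int_rect// -(pair_bigA _ (fun i j =>
    (c i j)%:E * (mu (A i `&` setT) * nu (B j `&` setT)))) /=.
  under eq_bigr => i _.
    under eq_bigr => j _ do
      rewrite !setIT muA nuB -!EFinM gab.
    rewrite sumEFin ga; over.
  by rewrite sumEFin a1.
have [pi piE] := density_probability mf f0 f1.
exists pi; split.
- move=> X mX; rewrite piE int_rect// -(pair_bigA _ (fun i j =>
    (c i j)%:E * (mu (A i `&` X) * nu (B j `&` setT)))) /=.
  rewrite [RHS](probability_partition mA tA _ mX); last first.
    by under eq_bigr do rewrite muA; rewrite sumEFin a1.
  apply: eq_bigr => i _; have [r -> /andP[r0 ra]] := fine_le _ _ mu _ _ _ (mA i) mX (muA i).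
  under eq_bigr => j _ do rewrite setIT nuB -!EFinM.
  rewrite sumEFin; congr EFin.
  (* A cell without mass cannot be divided by, but then [mu (A i]&[X)] is 0 as well. *)
  have [ai0|ai0] := eqVneq (a i) 0%R.
    have -> : r = 0%R by apply/le_anti; rewrite r0 -ai0 ra.
    by rewrite big1// => j _; rewrite mul0r mulr0.
  rewrite (eq_bigr (fun j => r / a i * g i j)%R).
    by rewrite -mulr_sumr ga divfK.
  by move=> j _; rewrite -gab; field.
- move=> X mX; rewrite piE int_rect// -(pair_bigA _ (fun i j =>
    (c i j)%:E * (mu (A i `&` setT) * nu (B j `&` X)))) /= exchange_big /=.
  rewrite [RHS](probability_partition mB tB _ mX); last first.
    by under eq_bigr do rewrite nuB; rewrite sumEFin b1.
  apply: eq_bigr => j _; have [r -> /andP[r0 rb]] := fine_le _ _ nu _ _ _ (mB j) mX (nuB j).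
  under eq_bigr => i _ do rewrite setIT muA -!EFinM.
  rewrite sumEFin; congr EFin.
  have [bj0|bj0] := eqVneq (b j) 0%R.
    have -> : r = 0%R by apply/le_anti; rewrite r0 -bj0 rb.
    by rewrite big1// => i _; rewrite !mulr0.
  rewrite (eq_bigr (fun i => r / b j * g i j)%R).
    by rewrite -mulr_sumr gb divfK.
  by move=> i _; rewrite -gab; field.
move=> i j; rewrite piE int_rect// (bigD1 (i, j))//= !setIid muA nuB.
rewrite -!EFinM gab big1 ?adde0// => -[k l]; rewrite xpair_eqE /= => kl.
have [ki|ki] := eqVneq k i; last first.
  suff -> : A k `&` A i = set0 by rewrite measure0 mul0e mule0.
  by rewrite -subset0 => x [Ak Ai]; move/eqP: ki; apply; exact: tA Ak Ai.
suff -> : B l `&` B j = set0 by rewrite measure0 !mule0.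
rewrite -subset0 => x [Bl Bj]; move: kl.
by rewrite ki (tB Bl Bj) !eqxx.
Qed.

End glue_coupling.

(** * Lebesgue measure on tuples *)

Definition box (R : realType) (n : nat) (a b : 'I_n -> R) : set (n.-tuple R) :=
  [set y | forall l, a l <= tnth y l < b l].

Lemma measurable_box (R : realType) (n : nat) (a b : 'I_n -> R) :
  measurable (box a b).
Proof.
have -> : box a b =
    \bigcap_(l in [set: 'I_n]) (@tnth n R ^~ l @^-1` `[a l, b l[%classic).
  apply/seteqP; split => [y aby l _|y aby l] /=; first by rewrite in_itv/=.
  by have := aby l I; rewrite /= in_itv.
apply: fin_bigcap_measurable => [|l _]; first exact: finite_finset.
by rewrite -[X in measurable X]setTI; apply: measurable_tnth.
Qed.

Section cons_measure.
Local Open Scope ereal_scope.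
Context (R : realType) (n : nat).
Variable L : {sigma_finite_measure set (n.-tuple R) -> \bar R}.
Hypothesis Lbox : forall a b : 'I_n -> R, (forall l, a l <= b l)%R ->
  L (box a b) = (\prod_l (b l - a l))%:E.

Let cons_pair (z : measurableTypeR R * n.-tuple R) : n.+1.-tuple R := [the n.+1.-tuple R of z.1 :: z.2].

Let measurable_cons_pair : measurable_fun setT cons_pair.
Proof. exact: measurable_cons. Qed.

Definition cons_measure : set (n.+1.-tuple R) -> \bar R :=
  pushforward (@lebesgue_measure R \x L) cons_pair.

Let cons_measureT : {measure set (n.+1.-tuple R) -> \bar R}.
Proof.
refine (pushforward (@lebesgue_measure R \x L) cons_pair).
exact: measurable_cons_pair.
Defined.

HB.instance Definition _ := Measure.copy cons_measure cons_measureT.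

Lemma cons_measure_box (a b : 'I_n.+1 -> R) : (forall l, a l <= b l)%R ->
  cons_measure (box a b) = (\prod_l (b l - a l))%:E.
Proof.
move=> ab; rewrite /cons_measure /pushforward.
have -> : cons_pair @^-1` box a b =
    `[a ord0, b ord0[%classic `*` box (a \o lift ord0) (b \o lift ord0).
  apply/seteqP; split => [[x t] /= abx|[x t] /= [/= x0 xt] l].
    split=> /= [|l]; first by rewrite in_itv /= (abx ord0).
    by have := abx (lift ord0 l); rewrite tnthS.
  have [l' ->|->] := unliftP ord0 l; last by rewrite in_itv/= in x0.
  by rewrite tnthS; exact: xt.
rewrite [LHS]product_measure1E//; last exact: measurable_box.
rewrite Lbox; last by move=> l; exact: ab.
rewrite big_ord_recl EFinM; congr (_ * _).
rewrite [LHS]lebesgue_measure_itv /= lte_fin.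
case: ltP => // ba; suff -> : a ord0 = b ord0 by rewrite subrr.
by apply/le_anti; rewrite ba ab.
Qed.

Let cons_measure_sigma_finite : sigma_finite setT cons_measure.
Proof.
exists (fun k => box (fun=> - k%:R)%R (fun=> k%:R)%R).
  apply/seteqP; split => // y _.
  (* The sum [s] bounds every coordinate; the successor makes the bound strict, as the open right
     ends of the boxes require. *)
  pose s := (\sum_l `|tnth y l|)%R; exists (Num.truncn s).+1 => //= l.
  suff ys : (`|tnth y l| < (Num.truncn s).+1%:R)%R.
    by move: ys; rewrite ltr_norml => /andP[/ltW -> ->].
  apply: le_lt_trans (truncnS_gt s).
  by rewrite /s (bigD1 l)//= lerDl sumr_ge0.
move=> k; split; first exact: measurable_box.
rewrite cons_measure_box ?ltry// => l.
by rewrite (@le_trans _ _ 0%R)// oppr_le0.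
Qed.

HB.instance Definition _ :=
  Measure_isSigmaFinite.Build _ _ _ cons_measure cons_measure_sigma_finite.

Lemma integral_cons_measure (f : n.+1.-tuple R -> \bar R) :
  measurable_fun setT f -> (forall y, 0 <= f y) ->
  \int[cons_measure]_y f y =
  \int[@lebesgue_measure R]_x \int[L]_t f (cons_tuple x t).
Proof.
move=> mf f0.
transitivity (\int[@lebesgue_measure R \x L]_z f (cons_pair z)).
  exact: (ge0_integral_pushforward measurable_cons_pair).
by rewrite fubini_tonelli1//; exact: measurableT_comp mf measurable_cons_pair.
Qed.

End cons_measure.

(** By induction, each dimension pushes forward the product of the line with the previous measure,
    and Tonelli identifies the integrals. The volume of boxes is carried along for two reasons: it
    yields the sigma-finiteness that the next use of Tonelli asks for, and later the volume of the
    cells. *)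
Lemma lebesgue_iterE (R : realType) (n : nat) :
  exists L : {sigma_finite_measure set (n.-tuple R) -> \bar R},
    (forall f, measurable_fun setT f -> (forall y, 0 <= f y)%E ->
      lebesgue_iter f = (\int[L]_y f y)%E) /\
    (forall a b : 'I_n -> R, (forall l, a l <= b l) ->
      L (box a b) = (\prod_l (b l - a l))%:E).
Proof.
elim: n => [|n [L [LE Lbox]]].
  (* In dimension 0 integration is evaluation at the empty tuple, and the only box has volume the
     empty product 1. *)
  exists (\d_ [tuple]); split => [f mf f0 /=|a b ab].
    by rewrite integral_dirac// diracT mul1e.
  rewrite big_ord0 /= diracE mem_set// => -[].
  by [].
exists (cons_measure L); split; last exact: cons_measure_box.
move=> f mf f0 /=; rewrite integral_cons_measure//.
apply: eq_integral => x _; rewrite LE//.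
apply: measurableT_comp mf _; exact: measurable_cons.
Unshelve. exact: Lbox.
Qed.

(** * Dyadic cells *)

Section cells.
Context {R : realType} {d : nat}.
Implicit Types (x y : d.-tuple R) (b k K : nat).

Lemma measurable_cell b (i : {ffun 'I_d -> 'I_b}) : measurable (@cell R d b i).
Proof. exact: measurable_box. Qed.

Lemma measurable_unit_cube : measurable (@unit_cube R d).
Proof. exact: (measurable_box (fun=> 0) (fun=> 1)). Qed.

Lemma cell_inj b (i j : {ffun 'I_d -> 'I_b}) y : cell i y -> cell j y -> i = j.
Proof.
move=> iy jy; apply/ffunP => l; apply/val_inj/eqP => /=.
have b0 : 0 < b%:R :> R by rewrite ltr0n (leq_ltn_trans _ (ltn_ord (i l))).
have /andP[il ir] := iy l; have /andP[jl jr] := jy l.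
have le m n : m%:R / b%:R < n.+1%:R / b%:R :> R -> (m <= n)%N.
  by rewrite ltr_pM2r ?invr_gt0// ltr_nat ltnS.
by rewrite eqn_leq !le ?(le_lt_trans il) ?(le_lt_trans jl).
Qed.

Lemma cell_cover b y : (0 < b)%N -> unit_cube y ->
  exists i : {ffun 'I_d -> 'I_b}, cell i y.
Proof.
move=> b0 cy; have b0' : 0 < b%:R :> R by rewrite ltr0n.
have yb0 l : 0 <= b%:R * tnth y l by rewrite mulr_ge0// ?ler0n//; case/andP: (cy l).
have yb l : (Num.truncn (b%:R * tnth y l) < b)%N.
  by rewrite truncn_lt_nat// gtr_pMr//; case/andP: (cy l).
exists [ffun l => Ordinal (yb l)] => l; rewrite ffunE /=.
rewrite ler_pdivrMr// ltr_pdivlMr// [tnth y l * _]mulrC; exact: truncn_itv.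
Qed.

Lemma ancestor_subproof K k (m : 'I_(2 ^ K)) : (m %/ 2 ^ (K - k) < 2 ^ k)%N.
Proof.
rewrite ltn_divLR ?expn_gt0// -expnD; apply: leq_trans (ltn_ord m) _.
by rewrite leq_pexp2l// -leq_subLR.
Qed.

(** The dyadic cell of level [k] above a leaf: the last [K - k] binary digits of each index are
    dropped. For [k > K] the truncated subtraction drops nothing, so refinement holds at all levels,
    as [tree_coupling] asks. *)
Definition ancestor K k (i : {ffun 'I_d -> 'I_(2 ^ K)}) :
  {ffun 'I_d -> 'I_(2 ^ k)} := [ffun l => Ordinal (ancestor_subproof k (i l))].

Lemma ancestor_refine K k (i j : {ffun 'I_d -> 'I_(2 ^ K)}) :
  ancestor k.+1 i = ancestor k.+1 j -> ancestor k i = ancestor k j.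
Proof.
move=> /ffunP ij; apply/ffunP => l; have := ij l; rewrite !ffunE => /(congr1 val)/= ijl.
apply: val_inj => /=.
have [kK|Kk] := ltnP k K; last first.
  have k0 : (K - k = 0)%N by apply/eqP; rewrite subn_eq0.
  have k1 : (K - k.+1 = 0)%N by apply/eqP; rewrite subn_eq0 leqW.
  by move: ijl; rewrite k0 k1.
by rewrite -subSS subSn// expnSr !divnMA ijl.
Qed.

Lemma ancestor0 K (i j : {ffun 'I_d -> 'I_(2 ^ K)}) : ancestor 0 i = ancestor 0 j.
Proof.
by apply/ffunP => l; rewrite !ffunE; apply: val_inj => /=; rewrite subn0 !divn_small.
Qed.

Lemma ancestor_cell K k (i : {ffun 'I_d -> 'I_(2 ^ K)}) y : (k <= K)%N ->
  cell i y -> cell (ancestor k i) y.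
Proof.
move=> kK iy l; have /andP[il ir] := iy l; rewrite ffunE /=.
have p0 e : 0 < (2 ^ e)%:R :> R by rewrite ltr0n expn_gt0.
have KE : (2 ^ K)%:R = (2 ^ k)%:R * (2 ^ (K - k))%:R :> R.
  by rewrite -natrM -expnD subnKC.
apply/andP; split.
- apply: le_trans il; rewrite ler_pdivrMr// mulrAC ler_pdivlMr// KE mulrCA.
  by rewrite [leRHS]mulrC ler_pM2l// -natrM ler_nat leq_divM.
- apply: (lt_le_trans ir); rewrite ler_pdivrMr// KE mulrA divfK ?gt_eqF//.
  by rewrite -natrM ler_nat; rewrite -ltn_divLR ?expn_gt0.
Qed.

(** Coordinates of two points of a cell differ by at most [1 / b], which bounds their distance by
    [d^(1/p) / b]. The two powers are kept apart so that the second becomes a power of [2^-v] on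
    dyadic cells. *)
Lemma cell_pdist (p v : R) b (c : {ffun 'I_d -> 'I_b}) x y :
  1 <= p -> 1 <= v -> cell c x -> cell c y ->
  pdist p x y `^ v <= (d%:R `^ p^-1) `^ v * (b%:R^-1) `^ v.
Proof.
move=> p1 v1 cx cy.
have p0 : 0 < p by exact: lt_le_trans p1.
have v0 : 0 <= v by exact: le_trans v1.
have xy l : `|tnth x l - tnth y l| `^ p <= b%:R^-1 `^ p.
  apply: ge0_ler_powR; rewrite ?(ltW p0) ?nnegrE ?invr_ge0//.
  have := cx l; have := cy l; rewrite -natr1 mulrDl mul1r.
  move=> /andP[yl yr] /andP[xl xr]; rewrite ler_norml; apply/andP; split; lra.
rewrite -powRM ?powR_ge0 ?invr_ge0//.
apply: ge0_ler_powR; rewrite ?nnegrE ?mulr_ge0 ?powR_ge0 ?invr_ge0//.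
apply: (@le_trans _ _ ((d%:R * b%:R^-1 `^ p) `^ p^-1)).
  apply: ge0_ler_powR; rewrite ?nnegrE ?invr_ge0 ?(ltW p0) ?sumr_ge0 ?mulr_ge0 ?powR_ge0//.
  apply: (le_trans (ler_sum _ (fun l _ => xy l))).
  by rewrite sumr_const card_ord mulr_natl.
by rewrite powRM ?powR_ge0// -powRrM divff ?gt_eqF// powRr1// invr_ge0.
Qed.

End cells.

Lemma total_cell_mass (R : realType) (d b : nat)
    (mu : probability (d.-tuple R) R) : (0 < b)%N -> in_Pd mu ->
  \sum_(i : {ffun 'I_d -> 'I_b}) fine (mu (cell i)) = 1.
Proof.
move=> b0 mu1.
have mcell (i : {ffun 'I_d -> 'I_b}) : measurable (@cell R d _ i) by exact: measurable_cell.
apply: EFin_inj; rewrite -sumEFin.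
rewrite (eq_bigr (fun i => mu (cell i))) => [|i _]; last first.
  by rewrite fineK// fin_num_measure.
rewrite -measure_finite_bigcup//; last by move=> i j y; exact: cell_inj.
have mU : measurable (\bigcup_(i : {ffun 'I_d -> 'I_b}) @cell R d _ i).
  by apply: fin_bigcup_measurable => // ; exact: finite_finset.
apply/eqP; rewrite eq_le probability_le1//=.
rewrite -mu1; apply: le_measure; rewrite ?inE//; first exact: measurable_unit_cube.
by move=> y /(cell_cover b0)[i iy]; exists i.
Qed.

(** * Wasserstein bound for histograms *)

Lemma measurable_hist_density (R : realType) (d b : nat)
    (w : {ffun 'I_d -> 'I_b} -> R) : measurable_fun setT (hist_density w).
Proof.
apply: measurable_sum => i; apply: measurable_funM => //.
by apply: measurable_indic; exact: measurable_cell.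
Qed.

(** [histogram] is only a set function defined by an iterated integral. A genuine probability
    agreeing with it on measurable sets suffices, since [coupling] tests measurable sets alone. *)
Lemma histogram_probability (R : realType) (d b : nat)
    (w : {ffun 'I_d -> 'I_b} -> R) : (0 < b)%N ->
  (forall i, 0 <= w i) -> \sum_i w i = 1 ->
  exists nu : probability (d.-tuple R) R,
    (forall B, measurable B -> histogram w B = nu B) /\
    (forall i, nu (cell i) = (w i)%:E).
Proof.
move=> b0 w0 w1; have [L [LE Lbox]] := lebesgue_iterE R d.
have b0' : 0 < b%:R :> R by rewrite ltr0n.
have Lcell (i : {ffun 'I_d -> 'I_b}) : L (cell i) = (b%:R^-1 ^+ d)%:E.
  transitivity (L (box (fun l => (i l)%:R / b%:R) (fun l => (i l).+1%:R / b%:R))).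
    by [].
  rewrite Lbox; last by move=> l; rewrite ler_pM2r ?invr_gt0// ler_nat.
  rewrite (eq_bigr (fun=> b%:R^-1)) ?prodr_const ?card_ord// => l _.
  by rewrite -mulrBl -natrB// subSnn mul1r.
have h0 y : 0 <= hist_density w y.
  by apply: sumr_ge0 => i _; rewrite !mulr_ge0 ?exprn_ge0 ?ler0n.
have mh : measurable_fun setT (fun y => (hist_density w y)%:E).
  by apply/measurable_EFinP; exact: measurable_hist_density.
have int_h X : measurable X -> (\int[L]_(y in X) (hist_density w y)%:E =
    \sum_i (b%:R ^+ d * w i)%:E * L (cell i `&` X))%E.
  move=> mX; under eq_integral do rewrite -sumEFin.
  rewrite ge0_integral_sum//.
  - apply: eq_bigr => i _; under eq_integral do rewrite EFinM.
    rewrite ge0_integralZl_EFin//.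
    + by rewrite integral_indic//; exact: measurable_cell.
    + apply/measurable_EFinP/measurable_funTS/measurable_indic.
      exact: measurable_cell.
    + by rewrite mulr_ge0// exprn_ge0.
  - move=> i; apply/measurable_EFinP/measurable_funTS/measurable_funM => //.
    by apply: measurable_indic; exact: measurable_cell.
  - by move=> i y _; rewrite lee_fin !mulr_ge0// ?exprn_ge0.
have bw i : ((b%:R ^+ d * w i)%:E * L (cell i) = (w i)%:E)%E.
  by rewrite Lcell -EFinM exprVn mulrAC divff ?mul1r// expf_neq0// gt_eqF.
have h1 : (\int[L]_y (hist_density w y)%:E = 1)%E.
  rewrite int_h//; under eq_bigr do rewrite setIT bw.
  by rewrite sumEFin w1.
have h0E y : (0 <= (hist_density w y)%:E)%E by rewrite lee_fin.
have [nu nuE] := density_probability mh h0E h1.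
exists nu; split=> [B mB|i].
  rewrite nuE /histogram LE.
  - rewrite [RHS]integral_mkcond; apply: eq_integral => y _.
    rewrite patchE indicE; case: ifPn => _; first by rewrite mul1r.
    by rewrite mul0r.
  - apply/measurable_EFinP/measurable_funM; first exact: measurable_indic.
    exact: measurable_hist_density.
  - by move=> y; rewrite lee_fin mulr_ge0.
have mcell : measurable (@cell R d b i) by exact: measurable_cell.
rewrite nuE int_h// (bigD1 i)//= setIid bw big1 ?adde0// => j ji.
suff -> : @cell R d b j `&` cell i = set0 by rewrite measure0 mule0.
by rewrite -subset0 => y [jy iy]; move/eqP: ji; apply; exact: cell_inj jy iy.
Qed.

Lemma powR_exprn (R : realType) (x u : R) k : 0 <= x ->
  (x ^+ k) `^ u = (x `^ u) ^+ k.
Proof.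
by move=> x0; rewrite -powR_mulrn// -powRrM mulrC powRrM powR_mulrn ?powR_ge0.
Qed.

Section wasserstein_tree.
Context {R : realType} (d : nat) (p v : R) (K : nat).
Hypotheses (p1 : 1 <= p) (v1 : 1 <= v).
Local Notation leaf := {ffun 'I_d -> 'I_(2 ^ K)}.
Local Notation q := (2^-1 `^ v).
Local Notation D := ((d%:R `^ p^-1) `^ v).

(** A majorant of the [v]-th power of the distance that is linear in the events that level [k.+1]
    separates the two leaves; the mass of these events is what [tree_coupling] controls. *)
Definition tree_cost (i j : leaf) : R :=
  D * (q ^+ K + \sum_(k < K) q ^+ k * (ancestor k.+1 i != ancestor k.+1 j)%:R).

Lemma tree_cost_ge0 i j : 0 <= tree_cost i j.
Proof.
rewrite mulr_ge0 ?powR_ge0// addr_ge0 ?exprn_ge0 ?powR_ge0//.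
by apply: sumr_ge0 => k _; rewrite mulr_ge0 ?exprn_ge0 ?powR_ge0.
Qed.

(** If [m.+1] is the first level separating the points, they share a cell of side [2^-m], and the
    summand [k = m] of the cost alone pays for their distance. If no level separates them, they
    share a leaf and the term [q ^+ K] pays. *)
Lemma pdist_tree_cost (i j : leaf) x y : cell i x -> cell j y ->
  pdist p x y `^ v <= tree_cost i j.
Proof.
move=> ix jy.
have q0 k : 0 <= q ^+ k by rewrite exprn_ge0 ?powR_ge0.
have sum0 (P : pred 'I_K) :
    0 <= \sum_(k < K | P k) q ^+ k * (ancestor k.+1 i != ancestor k.+1 j)%:R.
  by apply: sumr_ge0 => k _; rewrite mulr_ge0.
have same k : (k <= K)%N -> ancestor k i = ancestor k j ->
    pdist p x y `^ v <= D * q ^+ k.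
  move=> kK ij; have jy' := ancestor_cell kK jy; rewrite -ij in jy'.
  apply: le_trans (cell_pdist p1 v1 (ancestor_cell kK ix) jy') _.
  by rewrite natrX -exprVn powR_exprn// invr_ge0.
have [ijK|ijK] := eqVneq (ancestor K i) (ancestor K j).
  apply: le_trans (same K (leqnn K) ijK) _.
  by rewrite ler_wpM2l ?powR_ge0// lerDl sum0.
pose P k := ancestor k i != ancestor k j.
have exP : exists k, P k by exists K.
case: (ex_minnP exP) => -[|m] Pm minm.
  by move: Pm; rewrite /P (ancestor0 i j) eqxx.
have mK : (m < K)%N by exact: minm.
have ijm : ancestor m i = ancestor m j.
  by apply/eqP; rewrite -[_ == _]negbK; apply/negP => /minm; rewrite ltnn.
apply: le_trans (same m (ltnW mK) ijm) _.
rewrite ler_wpM2l ?powR_ge0// (bigD1 (Ordinal mK))//=.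
by rewrite -/(P m.+1) Pm mulr1 addrCA lerDl addr_ge0.
Qed.

(** The plan of [tree_coupling] on leaves is lifted by [glue_coupling] to a coupling of the two
    measures. Its cost bounds the infimum and is itself bounded by the finite sum of [tree_cost]
    against the plan. *)
Lemma wasserstein_tree (mu : probability (d.-tuple R) R) (w : leaf -> R) :
  in_Pd mu -> (forall i, 0 <= w i) -> \sum_i w i = 1 ->
  (wasserstein p v mu (histogram w) <=
   ((D * (q ^+ K + \sum_(k < K) q ^+ k * \sum_c
     `|\sum_(i : leaf | ancestor k.+1 i == c) fine (mu (cell i)) -
       \sum_(i : leaf | ancestor k.+1 i == c) w i|)) `^ v^-1)%:E)%E.
Proof.
move=> mu1 w0 w1; pose a (i : leaf) := fine (mu (cell i)).
have mcell (i : leaf) : measurable (@cell R d _ i) by exact: measurable_cell.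
have muE i : mu (cell i) = (a i)%:E by rewrite fineK// fin_num_measure.
have cell_tr (i j : leaf) (x : d.-tuple R) : cell i x -> cell j x -> i = j.
  exact: cell_inj.
have a1 : \sum_i a i = 1 by exact: total_cell_mass (expn_gt0 2 K) mu1.
have a0 i : 0 <= a i by rewrite fine_ge0.
have [nu [nuE nucell]] := histogram_probability (expn_gt0 2 K) w0 w1.
have [g [g0 ga gw gTV]] := tree_coupling K (@ancestor_refine d K)
  (@ancestor0 d K) a0 w0 (etrans a1 (esym w1)).
have [pi [pi1 pi2 picell]] :=
  glue_coupling mcell mcell cell_tr cell_tr muE nucell g0 ga gw a1 w1.
have cpi : coupling mu (histogram w) pi.
  by move=> B mB; rewrite pi1// pi2// nuE.
rewrite /wasserstein -poweR_EFin; apply: gt0_ler_poweR.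
- by rewrite invr_ge0 (le_trans _ v1).
- rewrite in_itv/= leey andbT; apply: le_ereal_inf_tmp => _ [pi' _ <-].
  by apply: integral_ge0 => z _; rewrite lee_fin powR_ge0.
- rewrite in_itv/= leey andbT lee_fin.
  rewrite mulr_ge0 ?powR_ge0// addr_ge0 ?exprn_ge0 ?powR_ge0//.
  apply: sumr_ge0 => k _; rewrite mulr_ge0 ?exprn_ge0 ?powR_ge0//.
  by apply: sumr_ge0 => c _.
apply: le_trans (ereal_inf_lbound _) _; first by exists pi; first exact: cpi.
pose AB (t : leaf * leaf) : set (d.-tuple R * d.-tuple R) :=
  cell t.1 `*` cell t.2.
have mAB t : measurable (AB t) by exact: measurableX.
have piAB t : pi (AB t) = (g t.1 t.2)%:E by exact: picell.
(* Pairs of points outside the products of leaves have no [tree_cost]; they form a null set, since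
   the plan has total mass 1. *)
pose N := ~` \bigcup_t AB t.
have mN : measurable N.
  by apply/measurableC/fin_bigcup_measurable => //; exact: finite_finset.
have AB_inj s t z : AB s z -> AB t z -> s = t.
  case: s t => [s1 s2] [t1 t2] [/= z1 z2] [/= z1' z2'].
  by rewrite (cell_inj z1 z1') (cell_inj z2 z2').
have N0 : (pi N = 0)%E.
  rewrite probability_setC; last by apply: fin_bigcup_measurable => //; exact: finite_finset.
  rewrite measure_finite_bigcup// (eq_bigr _ (fun t _ => piAB t)).
  rewrite sumEFin -(pair_bigA _ (fun i j => g i j)) /=.
  by under eq_bigr do rewrite ga; rewrite a1 subee.
pose G z := (\sum_(t : leaf * leaf) (tree_cost t.1 t.2)%:E * (\1_(AB t) z)%:E)%E.
have mG1 t : measurable_fun setT (fun z => (\1_(AB t) z : R)%:E).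
  by apply/measurable_EFinP; exact: measurable_indic.
have G10 t z : (0 <= (tree_cost t.1 t.2)%:E * (\1_(AB t) z)%:E)%E.
  by rewrite mule_ge0// lee_fin// tree_cost_ge0.
have mGt t : measurable_fun setT (fun z => (tree_cost t.1 t.2)%:E * (\1_(AB t) z)%:E)%E.
  exact: emeasurable_funM.
apply: (@le_trans _ _ (\int[pi]_z G z)%E).
  apply: (le_integral_off_null mN N0).
  - exact: emeasurable_sum.
  - by move=> z; rewrite lee_fin powR_ge0.
  - by move=> z; exact: sume_ge0.
  move=> z /contrapT[t _ tz]; rewrite /G (bigD1 t)//= indicE mem_set// mule1.
  rewrite -[leLHS]adde0; apply: leeD; last exact: sume_ge0.
  by case: tz => z1 z2; rewrite lee_fin; exact: pdist_tree_cost z1 z2.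
rewrite ge0_integral_sum//.
rewrite (eq_bigr (fun t => (tree_cost t.1 t.2 * g t.1 t.2)%:E)) => [|t _].
  rewrite sumEFin lee_fin -(pair_bigA _ (fun i j => tree_cost i j * g i j)) /=.
  rewrite (eq_bigr (fun i => D * (q ^+ K * \sum_j g i j + \sum_(k < K)
      q ^+ k * \sum_j g i j * (ancestor k.+1 i != ancestor k.+1 j)%:R))); last first.
    move=> i _; rewrite /tree_cost mulr_sumr.
    under [X in _ + X]eq_bigr do rewrite mulr_sumr.
    rewrite exchange_big -big_split /= mulr_sumr; apply: eq_bigr => j _.
    rewrite -mulrA; congr (_ * _); rewrite mulrDl; congr (_ + _).
    by rewrite mulr_suml; apply: eq_bigr => k _; rewrite -mulrA [g i j * _]mulrC.
  rewrite -mulr_sumr ler_wpM2l ?powR_ge0// big_split /= -mulr_sumr.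
  rewrite (eq_bigr a (fun i _ => ga i)).
  rewrite a1 mulr1 lerD2l exchange_big /=; apply: ler_sum => k _.
  by rewrite -mulr_sumr ler_wpM2l ?exprn_ge0 ?powR_ge0// gTV.
rewrite ge0_integralZl_EFin ?tree_cost_ge0// integral_indic// setIT [RHS]EFinM.
by rewrite -(piAB t).
Qed.

End wasserstein_tree.

(** * Variance of the counts *)

Section count_variance.
Context {R : realType} {dO : measure_display} {Omega : measurableType dO}
  (P : probability Omega R) (d : nat) (Y : nat -> Omega -> d.-tuple R)
  (P0 : probability (d.-tuple R) R).
Hypothesis iidY : iid_with_law P Y P0.
Variables (B : set (d.-tuple R)) (n : nat).
Hypothesis mB : measurable B.

Let a : R := fine (P0 B).
Let N (w : Omega) : R := \sum_(t < n) \1_B (Y t w).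
Let E (t : nat) : set Omega := Y t @^-1` B.

Lemma measurable_preimage_sample t : measurable (E t).
Proof.
have [mY _ _] := iidY.
by rewrite /E -[X in measurable X]setTI; exact: mY.
Qed.

Lemma measurable_indic_sample t :
  measurable_fun setT (fun w => \1_B (Y t w) : R).
Proof.
have [mY _ _] := iidY.
by apply: (measurableT_comp _ (mY t)); exact: measurable_indic.
Qed.

Lemma measurable_count : measurable_fun setT N.
Proof. by apply: measurable_sum => t; exact: measurable_indic_sample. Qed.

Lemma pair_probability (s t : nat) :
  P (E s `&` E t) = (if s == t then a else a ^+ 2)%:E.
Proof.
have [mY Y_law Y_indep] := iidY.
have PE u : P (E u) = a%:E by rewrite Y_law// fineK// fin_num_measure.
case: eqVneq => [->|st]; first by rewrite setIid.
have := Y_indep [:: s; t] (fun=> B); rewrite /= inE st => /(_ isT (fun=> mB)).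
by rewrite !big_cons !big_nil setIT mule1 !PE => ->.
Qed.

(** The pair probabilities give the second moment [n a + n (n - 1) a^2], hence the variance
    [n a (1 - a)], and the term [- n a^2] is dropped. *)
Lemma count_variance :
  (\int[P]_w ((N w - n%:R * a) ^+ 2)%:E <= (n%:R * a)%:E)%E.
Proof.
have a0 : 0 <= a by rewrite fine_ge0.
have mI t : measurable_fun setT (fun w => (\1_B (Y t w))%:E : \bar R).
  by apply/measurable_EFinP; exact: measurable_indic_sample.
have intI s t : (\int[P]_w (\1_B (Y s w) * \1_B (Y t w))%:E =
    (if s == t then a else a ^+ 2)%:E)%E.
  rewrite -pair_probability -[E s `&` E t]setIT -integral_indic//; last first.
    by apply: measurableI; exact: measurable_preimage_sample.
  by apply: eq_integral => w _; rewrite indicI.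
have N0 w : 0 <= N w by apply: sumr_ge0.
have intN : (\int[P]_w (N w)%:E = (n%:R * a)%:E)%E.
  under eq_integral do rewrite -sumEFin.
  rewrite ge0_integral_sum//.
  rewrite (eq_bigr (fun=> a%:E)) => [|t _].
    by rewrite sumEFin sumr_const card_ord mulr_natl.
  have := intI t t; rewrite eqxx => <-; apply: eq_integral => w _.
  by rewrite indicE; case: (_ \in _); rewrite ?mulr1 ?mulr0.
have intN2 : (\int[P]_w (N w ^+ 2)%:E =
    (n%:R * a + n%:R * (n%:R - 1) * a ^+ 2)%:E)%E.
  have -> : (\int[P]_w (N w ^+ 2)%:E =
      \int[P]_w \sum_(s < n) \sum_(t < n) (\1_B (Y s w) * \1_B (Y t w))%:E)%E.
    apply: eq_integral => w _; rewrite expr2 /N mulr_suml -sumEFin.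
    by apply: eq_bigr => s _; rewrite mulr_sumr -sumEFin.
  have mII s t : measurable_fun setT (fun w => (\1_B (Y s w) * \1_B (Y t w))%:E : \bar R).
    by apply/measurable_EFinP/measurable_funM; exact: measurable_indic_sample.
  rewrite ge0_integral_sum//; last 2 first.
  - by move=> s; exact: emeasurable_sum.
  - by move=> s w _; apply: sume_ge0 => t _; rewrite lee_fin.
  rewrite (eq_bigr (fun=> (a + (n%:R - 1) * a ^+ 2)%:E)) => [|s _].
    rewrite sumEFin sumr_const card_ord -mulr_natl; congr EFin; ring.
  rewrite ge0_integral_sum//; under eq_bigr do rewrite intI.
  rewrite sumEFin; congr EFin; rewrite (bigD1 s)//= eqxx; congr (_ + _).
  rewrite (eq_bigr (fun=> a ^+ 2)) => [|t]; last first.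
    by rewrite eq_sym -val_eqE => /negbTE ->.
  rewrite sumr_const cardC1 card_ord.
  by case: (n) (s) => [[]//|m] _; rewrite -[m.+1%:R]natr1 addrK mulr_natl.
set V := (\int[P]_w _)%E.
have mN : measurable_fun setT N by exact: measurable_count.
(* The square is expanded with the cross term moved to the left, so that only integrals of
   nonnegative functions are added; the finite cross term is subtracted at the end. *)
have VE : (V + (2 * (n%:R * a) * (n%:R * a))%:E =
    (n%:R * a + n%:R * (n%:R - 1) * a ^+ 2 + (n%:R * a) ^+ 2)%:E)%E.
  have na0 : 0 <= 2 * (n%:R * a) by rewrite !mulr_ge0.
  rewrite EFinM -intN -ge0_integralZl_EFin//; last 2 first.
  - by move=> w _; rewrite lee_fin.
  - exact/measurable_EFinP.
  rewrite -ge0_integralD//; last 4 first.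
  - by move=> w _; rewrite lee_fin sqr_ge0.
  - by apply/measurable_EFinP/measurable_funX/measurable_funB.
  - by move=> w _; rewrite lee_fin mulr_ge0.
  - by apply/measurable_EFinP/measurable_funM.
  rewrite [RHS]EFinD -intN2 -[X in (_ + X)%E]mule1 -(probability_setT P) -integral_cst//.
  rewrite -ge0_integralD//; last 3 first.
  - by move=> w _; rewrite lee_fin sqr_ge0.
  - by apply/measurable_EFinP/measurable_funX.
  - by move=> w _; rewrite lee_fin sqr_ge0.
  apply: eq_integral => w _; rewrite -!EFinM -!EFinD; congr EFin; ring.
have -> : V = (n%:R * a - n%:R * a ^+ 2)%:E.
  pose c := (2 * (n%:R * a) * (n%:R * a))%:E.
  transitivity (V + c - c)%E; first by rewrite addeK.
  by rewrite VE -EFinB; congr EFin; ring.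
by rewrite lee_fin gerBl mulr_ge0// sqr_ge0.
Qed.

End count_variance.

(** * Posterior weights *)

Section ancestor_cells.
Context {R : realType} {d : nat} (K k : nat).
Local Notation leaf := {ffun 'I_d -> 'I_(2 ^ K)}.

(** The cell [c] as a union of leaves instead of a product of intervals: its indicator and its mass
    are then sums over the leaves below [c], which is the form of the sums in [wasserstein_tree]. *)
Definition ancestor_block (c : {ffun 'I_d -> 'I_(2 ^ k)}) : set (d.-tuple R) :=
  \bigcup_(i in [set i : leaf | ancestor k i = c]) cell i.

Lemma measurable_ancestor_block c : measurable (ancestor_block c).
Proof.
apply: fin_bigcup_measurable => [|i _]; first exact: finite_finset.
exact: measurable_cell.
Qed.

Lemma indic_ancestor_block c (y : d.-tuple R) :
  \1_(ancestor_block c) y = \sum_(i : leaf | ancestor k i == c) \1_(cell i) y :> R.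
Proof.
have [[i ic iy]|yNc] := pselect (ancestor_block c y).
  rewrite indicE mem_set; last by exists i.
  rewrite (bigD1 i) ?(introT eqP ic)//= indicE mem_set// big1 ?addr0//.
  move=> j /andP[_ ji]; rewrite indicE memNset// => jy.
  by move/eqP: ji; apply; exact: cell_inj jy iy.
rewrite indicE memNset// big1// => i /eqP ic.
by rewrite indicE memNset// => iy; apply: yNc; exists i.
Qed.

Lemma fine_ancestor_block (mu : probability (d.-tuple R) R) c :
  fine (mu (ancestor_block c)) =
  \sum_(i : leaf | ancestor k i == c) fine (mu (cell i)).
Proof.
have mcell (i : leaf) : measurable (@cell R d _ i) by exact: measurable_cell.
apply: EFin_inj; rewrite fineK ?fin_num_measure//; last first.
  exact: measurable_ancestor_block.
rewrite -[ancestor_block c]setIT -integral_indic//; last first.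
  exact: measurable_ancestor_block.
under eq_integral do rewrite indic_ancestor_block -sumEFin -big_filter.
rewrite ge0_integral_sum//; last first.
  by move=> i; apply/measurable_EFinP; exact: measurable_indic.
rewrite big_filter -sumEFin; apply: eq_bigr => i _.
by rewrite integral_indic// setIT fineK// fin_num_measure.
Qed.

End ancestor_cells.

Section posterior.
Context {R : realType} {d : nat} (K n : nat).
Local Notation leaf := {ffun 'I_d -> 'I_(2 ^ K)}.
Variables (alpha : leaf -> R) (ys : nat -> d.-tuple R).
Hypotheses (n0 : (0 < n)%N) (alpha0 : forall i, 0 <= alpha i)
  (ysP : forall t : 'I_n, unit_cube (ys t)).
Let S := \sum_i alpha i.
Let w (i : leaf) : R :=
  post_conc alpha ys n i / \sum_j post_conc alpha ys n j.

Let S0 : 0 <= S. Proof. by apply: sumr_ge0 => i _. Qed.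
Let n0R : 0 < n%:R :> R. Proof. by rewrite ltr0n. Qed.

Let fiber_sum k c :
  \sum_(i : leaf | ancestor k i == c) post_conc alpha ys n i =
  \sum_(i | ancestor k i == c) alpha i +
  \sum_(t < n) \1_(ancestor_block K c) (ys t).
Proof.
rewrite big_split /= exchange_big; congr (_ + _).
by apply: eq_bigr => t _; rewrite indic_ancestor_block.
Qed.

Lemma total_post_conc : \sum_j post_conc alpha ys n j = S + n%:R.
Proof.
rewrite big_split /= exchange_big/=; congr (_ + _).
rewrite (eq_bigr (fun=> 1)) ?sumr_const ?card_ord// => t _.
have [i iy] := cell_cover (expn_gt0 2 K) (ysP t).
rewrite (bigD1 i)//= indicE mem_set// big1 ?addr0// => j ji.
rewrite indicE memNset// => jy.
by move/eqP: ji; apply; exact: cell_inj jy iy.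
Qed.

Let M0 : 0 < S + n%:R.
Proof. by rewrite ltr_wpDl. Qed.

Lemma posterior_weight_ge0 i : 0 <= w i.
Proof.
rewrite /w total_post_conc divr_ge0 ?(ltW M0)// addr_ge0//.
by apply: sumr_ge0 => t _.
Qed.

Lemma posterior_weight_sum : \sum_i w i = 1.
Proof. by rewrite -mulr_suml total_post_conc divff// gt_eqF. Qed.

Lemma posterior_tv (mu : probability (d.-tuple R) R) (k : nat) :
  in_Pd mu ->
  \sum_c `|\sum_(i : leaf | ancestor k i == c) fine (mu (cell i)) -
           \sum_(i : leaf | ancestor k i == c) w i| <=
  2 * S / n%:R + (\sum_c `|\sum_(t < n) \1_(ancestor_block K (k := k) c) (ys t) -
     n%:R * fine (mu (ancestor_block K c))|) / n%:R.
Proof.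
move=> mu1.
pose a c := fine (mu (ancestor_block K (k := k) c)).
pose N c : R := \sum_(t < n) \1_(ancestor_block K (k := k) c) (ys t).
pose al c := \sum_(i : leaf | ancestor k i == c) alpha i.
have a1 : \sum_c a c = 1.
  rewrite /a; under eq_bigr do rewrite fine_ancestor_block.
  by rewrite -(total_cell_mass (expn_gt0 2 K) mu1) -(sum_fiber (ancestor k)).
have alS : \sum_c al c = S by rewrite /al -(sum_fiber (ancestor k)).
have a0 c : 0 <= a c by rewrite fine_ge0.
have al0 c : 0 <= al c by apply: sumr_ge0.
apply: (@le_trans _ _ (\sum_c (S * a c + al c + `|N c - n%:R * a c|) / n%:R)).
  apply: ler_sum => c _.
  rewrite -fine_ancestor_block -/(a c) -mulr_suml fiber_sum -/(al c) -/(N c).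
  rewrite total_post_conc.
  (* Over the denominator [S + n], the prior error [S * a c - al c] separates from the sampling
     error [N c - n * a c]. Summed over the cells, the prior part is at most [2 * S]. *)
  have -> : a c - (al c + N c) / (S + n%:R) =
      (S * a c - al c - (N c - n%:R * a c)) / (S + n%:R).
    by field; rewrite gt_eqF.
  rewrite normrM [`|_^-1|]ger0_norm ?invr_ge0 ?(ltW M0)//.
  apply: ler_pM; rewrite ?invr_ge0 ?(ltW M0)//.
    apply: le_trans (ler_normB _ _) _; rewrite lerD2r.
    apply: le_trans (ler_normB _ _) _.
    by rewrite !ger0_norm// mulr_ge0.
  by rewrite lef_pV2 ?posrE// lerDr.
rewrite -mulr_suml !big_split /= -mulr_sumr a1 alS -mulrDl.
by rewrite mulr1 -[S + S]mulr2n mulr_natl.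
Qed.

End posterior.

(** * Expected Wasserstein distance *)

(** For [y = x / B], the power [y^(1/v)] is at most 1 when [y <= 1] and at most [y] otherwise, hence
    at most [1 + y]. With [B] a bound on the mean of [x], the right side has mean at most
    [2 * B^(1/v)]. *)
Lemma powR_tangent (R : realType) (u v B x : R) : 1 <= v -> 0 < B -> 0 <= x ->
  x `^ v^-1 <= B `^ v^-1 * (1 + x / B).
Proof.
move=> v1 B0 x0; have v0 : 0 < v by exact: lt_le_trans v1.
have y0 : 0 <= x / B by rewrite divr_ge0// ltW.
rewrite -[in leLHS](divfK (lt0r_neq0 B0) x) mulrC powRM ?(ltW B0)//.
rewrite ler_wpM2l ?powR_ge0//.
have [y1|/ltW y1] := lerP (x / B) 1.
  apply: (@le_trans _ _ 1); last by rewrite lerDl.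
  apply: (@le_trans _ _ (1 `^ v^-1)); last by rewrite powR1.
  by apply: ge0_ler_powR; rewrite ?nnegrE ?invr_ge0 ?(ltW v0).
apply: (@le_trans _ _ (x / B)); last by rewrite lerDr.
by apply: ler1_powR => //; rewrite invf_le1.
Qed.

Section expected_wasserstein.
Context {R : realType} {dO : measure_display} {Omega : measurableType dO}
  (P : probability Omega R) (d : nat) (Y : nat -> Omega -> d.-tuple R)
  (P0 : probability (d.-tuple R) R).
Hypotheses (iidY : iid_with_law P Y P0) (cubeP0 : in_Pd P0).
Variables (p v : R) (K n : nat) (alpha : {ffun 'I_d -> 'I_(2 ^ K)} -> R) (B : R).
Hypotheses (p1 : 1 <= p) (v1 : 1 <= v) (n0 : (0 < n)%N)
  (alpha0 : forall i, 0 <= alpha i) (B0 : 0 < B).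
Local Notation q := (2^-1 `^ v).
Local Notation D := ((d%:R `^ p^-1) `^ v).
Let S := \sum_i alpha i.
(** The square root of the number of cells of level [k.+1] per sample point: the order of the mean
    total deviation of the empirical frequencies at that level. *)
Let r (k : nat) : R := Num.sqrt (((2 ^ k.+1) ^ d)%:R / n%:R).
Let blk (k : nat) := @ancestor_block R d K k.+1.
Arguments blk : clear implicits.
Let a k c : R := fine (P0 (blk k c)).
Arguments a : clear implicits.
Let N k c (w : Omega) : R := \sum_(t < n) \1_(blk k c) (Y t w).
Arguments N : clear implicits.
(** [X] bounds the [v]-th power of the distance, with absolute deviations replaced by squares, whose
    means are variances. The deterministic terms go into [c0], and [e k] is the coefficient of the
    squares of level [k.+1]. *)
Let c0 : R := D * (q ^+ K + \sum_(k < K) q ^+ k * (2 * S / n%:R + r k / 2)).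
Let e (k : nat) : R := D * (q ^+ k * (r k / (2 * n%:R))).
Let X (w : Omega) : R :=
  c0 + \sum_(k < K) \sum_c e k * (N k c w - n%:R * a k c) ^+ 2.

Let n0R : 0 < n%:R :> R. Proof. by rewrite ltr0n. Qed.
Let r0 k : 0 < r k.
Proof. by rewrite sqrtr_gt0 divr_gt0// ltr0n !expn_gt0. Qed.
Let q0 k : 0 <= q ^+ k. Proof. by rewrite exprn_ge0 ?powR_ge0. Qed.
Let e0 k : 0 <= e k.
Proof. by rewrite !mulr_ge0 ?powR_ge0 ?(ltW (r0 k))// invr_ge0 mulr_ge0. Qed.
Let S0 : 0 <= S. Proof. by apply: sumr_ge0 => i _. Qed.
Let c00 : 0 <= c0.
Proof.
rewrite mulr_ge0 ?powR_ge0// addr_ge0//; apply: sumr_ge0 => k _.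
by rewrite mulr_ge0// addr_ge0 ?divr_ge0 ?mulr_ge0 ?(ltW (r0 k)) ?(ltW n0R).
Qed.
Let X0 w : 0 <= X w.
Proof.
rewrite addr_ge0//; apply: sumr_ge0 => k _; apply: sumr_ge0 => c _.
by rewrite mulr_ge0// sqr_ge0.
Qed.

Let W (w : Omega) : \bar R :=
  wasserstein p v P0 (hist_estimator alpha (fun t => Y t w) n).

Let wasserstein_le w : (forall t : 'I_n, unit_cube (Y t w)) ->
  (W w <= ((X w) `^ v^-1)%:E)%E.
Proof.
move=> cubeY.
apply: le_trans (wasserstein_tree p1 v1 cubeP0 _ _) _.
- exact: posterior_weight_ge0.
- exact: posterior_weight_sum.
rewrite lee_fin; apply: ge0_ler_powR.
- by rewrite invr_ge0 (le_trans _ v1).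
- rewrite nnegrE mulr_ge0 ?powR_ge0// addr_ge0//.
  by apply: sumr_ge0 => k _; rewrite mulr_ge0//; apply: sumr_ge0.
- by rewrite nnegrE.
have -> : X w = D * (q ^+ K + \sum_(k < K) q ^+ k * ((2 * S / n%:R + r k / 2) +
    \sum_c r k / (2 * n%:R) * (N k c w - n%:R * a k c) ^+ 2)).
  rewrite /X /c0 /e; under [in RHS]eq_bigr do rewrite mulrDr.
  rewrite [in RHS]big_split /= addrA [RHS]mulrDr; congr (_ + _).
  rewrite mulr_sumr; apply: eq_bigr => k _.
  by rewrite !mulr_sumr; apply: eq_bigr => c _; rewrite !mulrA.
rewrite ler_wpM2l ?powR_ge0// lerD2l; apply: ler_sum => k _.
rewrite ler_wpM2l//.
apply: le_trans (posterior_tv n0 alpha0 cubeY _ cubeP0) _.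
rewrite -[leRHS]addrA lerD2l.
(* AM-GM with the weight [r k], the same for all the [2 ^ (k.+1 * d)] cells
   of the level: their constant terms then add up to [r k / 2]. *)
have amgm (x : R) : `|x| / n%:R <= r k / (2 * n%:R) * x ^+ 2 + (r k)^-1 / (2 * n%:R).
  have -> : r k / (2 * n%:R) * x ^+ 2 + (r k)^-1 / (2 * n%:R) =
      `|x| / n%:R + (`|x| * r k - 1) ^+ 2 / (2 * r k * n%:R).
    by rewrite -(real_normK (num_real x)); field; rewrite !gt_eqF.
  by rewrite lerDl divr_ge0 ?sqr_ge0// !mulr_ge0// ltW.
rewrite mulr_suml; apply: (le_trans (ler_sum _ (fun c _ => amgm _))).
rewrite big_split /= addrC lerD2r sumr_const card_ffun !card_ord.
rewrite -[leLHS]mulr_natr.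
have -> : r k / 2 = (r k)^-1 * (r k ^+ 2) / 2.
  by rewrite expr2 mulKf// gt_eqF.
rewrite sqr_sqrtr ?divr_ge0// le_eqVlt; apply/orP; left; apply/eqP.
by field; rewrite !gt_eqF.
Qed.

Let mN k c : measurable_fun setT (N k c).
Proof. by apply: (measurable_count iidY); exact: measurable_ancestor_block. Qed.

Let mX : measurable_fun setT (fun w => (X w)%:E).
Proof.
apply/measurable_EFinP/measurable_funD => //.
apply: measurable_sum => k; apply: measurable_sum => c.
by apply: measurable_funM => //; apply: measurable_funX; exact: measurable_funB.
Qed.

Let meanX : (\int[P]_w (X w)%:E <=
  (D * (q ^+ K + \sum_(k < K) q ^+ k * (2 * S / n%:R + r k)))%:E)%E.
Proof.
have mZ (k : nat) c : measurable_fun setT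
    (fun w => (e k * (N k c w - n%:R * a k c) ^+ 2)%:E : \bar R).
  apply/measurable_EFinP/measurable_funM => //.
  by apply: measurable_funX; apply: measurable_funB.
have Z0 (k : nat) c w : (0 <= (e k * (N k c w - n%:R * a k c) ^+ 2)%:E)%E.
  by rewrite lee_fin mulr_ge0// sqr_ge0.
under eq_integral do rewrite EFinD -sumEFin.
rewrite ge0_integralD//; last 2 first.
- by move=> w _; apply: sume_ge0 => k _; rewrite lee_fin sumr_ge0// => c _; rewrite -lee_fin.
- apply: emeasurable_sum => k; under eq_fun do rewrite -sumEFin.
  exact: emeasurable_sum.
rewrite integral_cst// [X in (_ * X)%E](probability_setT P) mule1.
rewrite ge0_integral_sum//; last 2 first.
- by move=> k; under eq_fun do rewrite -sumEFin; exact: emeasurable_sum.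
- by move=> k w _; rewrite lee_fin sumr_ge0// => c _; rewrite -lee_fin.
(* Half of each [r k] is already in [c0]; the other half comes from the variances, as
   [e k * n = D * q ^+ k * r k / 2]. The cell masses sum to 1, so the variances of a level add up to
   at most [n]. *)
have -> : D * (q ^+ K + \sum_(k < K) q ^+ k * (2 * S / n%:R + r k)) =
    c0 + \sum_(k < K) e k * n%:R.
  rewrite /c0 /e !mulrDr -addrA; congr (_ + _).
  rewrite !mulr_sumr -big_split; apply: eq_bigr => k _ /=.
  by field; rewrite gt_eqF.
rewrite EFinD -sumEFin; apply: leeD2l; apply: lee_sum => k _.
under eq_integral do rewrite -sumEFin.
rewrite ge0_integral_sum//.
have a1 : \sum_c a k c = 1.
  rewrite /a /blk; under eq_bigr do rewrite fine_ancestor_block.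
  by rewrite -(total_cell_mass (expn_gt0 2 K) cubeP0) -(sum_fiber (ancestor k.+1)).
have -> : e k * n%:R = \sum_c e k * (n%:R * a k c) by rewrite -!mulr_sumr a1 mulr1.
rewrite -sumEFin; apply: lee_sum => c _.
under eq_integral do rewrite EFinM.
rewrite ge0_integralZl_EFin//; last 2 first.
- by move=> w _; rewrite lee_fin sqr_ge0.
- by apply/measurable_EFinP/measurable_funX/measurable_funB.
rewrite [leRHS]EFinM lee_wpmul2l ?lee_fin//.
by apply: (count_variance iidY); exact: measurable_ancestor_block.
Qed.

Lemma expected_wasserstein :
  D * (q ^+ K + \sum_(k < K) q ^+ k * (2 * S / n%:R +
    Num.sqrt (((2 ^ k.+1) ^ d)%:R / n%:R))) <= B ->
  (\int[P]_w W w <= (2 * B `^ v^-1)%:E)%E.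
Proof.
move=> meanB.
have [mY Y_law _] := iidY.
(* The posterior weights are known to sum to 1 only when the [n] observations lie in the cube. This
   fails on a finite union of null events. *)
pose G := \bigcap_(t in [set: 'I_n]) (Y t @^-1` @unit_cube R d).
have mYcube (t : nat) : measurable (Y t @^-1` @unit_cube R d).
  by rewrite -[X in measurable X]setTI; apply: mY => //; exact: measurable_unit_cube.
have mG : measurable (~` G).
  by apply: measurableC; apply: fin_bigcap_measurable => //; exact: finite_finset.
have G0 : (P (~` G) = 0)%E.
  apply/eqP; rewrite eq_le measure_ge0 andbT /G setC_bigcap.
  have Yc (t : nat) : (P (~` (Y t @^-1` @unit_cube R d)) = 0)%E.
    rewrite probability_setC// Y_law; last exact: measurable_unit_cube.
    by rewrite cubeP0 subee.
  apply: (le_trans (@content_sub_fsum _ _ _ P _ [set: 'I_n] _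
    (fun t => ~` (Y t @^-1` @unit_cube R d)) _ _ _ _)) => //.
  - exact: finite_finset.
  - by move=> t _; exact: measurableC.
  - by rewrite -setC_bigcap.
  - by rewrite fsbig1// => t _; exact: Yc.
pose h w := 1 + B^-1 * X w.
have h0 w : 0 <= h w by rewrite addr_ge0// mulr_ge0// invr_ge0 ltW.
have mh : measurable_fun setT h.
  by apply: measurable_funD => //; apply: measurable_funM => //; apply/measurable_EFinP.
pose g w := (B `^ v^-1 * h w)%:E.
apply: (@le_trans _ _ (\int[P]_w g w)%E).
  apply: (le_integral_off_null mG G0).
  - by apply/measurable_EFinP; exact: measurable_funM.
  - by move=> w; exact: poweR_ge0.
  - by move=> w; rewrite lee_fin mulr_ge0 ?powR_ge0.
  move=> w /contrapT Gw; apply: le_trans (wasserstein_le _) _.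
    by move=> t; exact: Gw.
  by rewrite lee_fin /h [B^-1 * _]mulrC; exact: powR_tangent.
have Xi0 w : (0 <= (B^-1)%:E * (X w)%:E)%E.
  by rewrite mule_ge0// lee_fin// invr_ge0 ltW.
have mXi : measurable_fun setT (fun w => (B^-1)%:E * (X w)%:E)%E.
  exact: emeasurable_funM.
rewrite /g; under eq_integral do rewrite EFinM.
rewrite ge0_integralZl_EFin ?powR_ge0//; last 2 first.
- by move=> w _; rewrite lee_fin.
- exact/measurable_EFinP.
rewrite [leRHS]EFinM muleC; apply: lee_wpmul2r; first by rewrite lee_fin powR_ge0.
under eq_integral do rewrite EFinD EFinM.
rewrite ge0_integralD// integral_cst// [X in (_ * X)%E](probability_setT P) mule1.
rewrite ge0_integralZl_EFin ?invr_ge0 ?(ltW B0)//; last by move=> w _; rewrite lee_fin.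
apply: (@le_trans _ _ (1 + (B^-1)%:E * B%:E)%E).
  rewrite leeD2l// lee_wpmul2l// ?lee_fin ?invr_ge0 ?(ltW B0)//.
  by apply: le_trans meanX _; rewrite lee_fin.
by rewrite -EFinM mulVf ?gt_eqF// -EFinD lee_fin.
Qed.

End expected_wasserstein.

(** * Rates *)

Section rates.
Context {R : realType} (d : nat) (v : R).
Hypothesis v1 : 1 <= v.
Let v0 : 0 < v. Proof. exact: lt_le_trans v1. Qed.
Local Notation q := (2^-1 `^ v).
Local Notation tau := (2 `^ (d%:R / 2) : R).
Local Notation rho := (2 `^ (d%:R / 2 - v) : R).

Lemma powR_natl_ge1 (n : nat) (u : R) : (0 < n)%N -> 0 <= u -> 1 <= n%:R `^ u.
Proof.
move=> n0 u0; rewrite -[leLHS](powRr0 n%:R); apply: ler_powR => //.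
by rewrite ler1n.
Qed.

Lemma k_seq_ge1 n : (0 < n)%N -> 1 <= k_seq d v n.
Proof.
move=> n0; rewrite /k_seq; case: ifP => _; apply: powR_natl_ge1 => //.
by rewrite invr_ge0 mulr_ge0// ltW.
Qed.

Lemma K_seq_bounds n : (0 < n)%N ->
  ln (k_seq d v n) / ln 2 <= (K_seq d v n)%:R <= ln (k_seq d v n) / ln 2 + 1.
Proof.
move=> n0; set x := ln _ / _.
have x0 : 0 <= x by rewrite divr_ge0 ?ln_ge0 ?k_seq_ge1// ler1n.
(* The ceiling is nonnegative because [k_seq] is at least 1, so the absolute value in [K_seq]
   changes nothing. *)
have -> : (K_seq d v n)%:R = (Num.ceil x)%:~R :> R.
  rewrite /K_seq -/x -[in RHS](gez0_abs (_ : 0 <= Num.ceil x))//.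
  by rewrite ceil_ge0 (lt_le_trans _ x0)// ltrN10.
rewrite ceil_ge /=.
have := ceil_itv x; rewrite intrD => /andP[+ _]; lra.
Qed.

Lemma two_pow_K_seq n : (0 < n)%N ->
  k_seq d v n <= 2 ^+ K_seq d v n <= 2 * k_seq d v n.
Proof.
move=> n0; have k1 := k_seq_ge1 n0; have k0 : 0 < k_seq d v n by exact: lt_le_trans k1.
have ln20 : 0 < ln 2 :> R by rewrite ln_gt0// ltr1n.
have /andP[Kl Kr] := K_seq_bounds n0.
rewrite -(powR_mulrn (K_seq d v n) (ler0n R 2)) /powR pnatr_eq0 /=.
apply/andP; split.
  by rewrite -[leLHS](lnK k0) ler_expR -ler_pdivrMr.
rewrite -[leRHS]lnK ?posrE ?mulr_gt0// ler_expR lnM ?posrE// -ler_pdivlMr//.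
by rewrite mulrDl divff ?gt_eqF// addrC.
Qed.

Lemma geometric_sum_le (x : R) K : 0 <= x < 1 -> \sum_(k < K) x ^+ k <= (1 - x)^-1.
Proof.
move=> /andP[x0 x1]; rewrite -[leRHS]mul1r ler_pdivlMr ?subr_gt0//.
have xK : 0 <= x ^+ K by rewrite exprn_ge0.
by rewrite -opprB mulrN [_ * (x - 1)]mulrC -subrX1; lra.
Qed.

Lemma geometric_sum_gt1 (x : R) K : 1 < x -> \sum_(k < K) x ^+ k <= x ^+ K / (x - 1).
Proof.
move=> x1; rewrite ler_pdivlMr ?subr_gt0//.
by rewrite mulrC -subrX1; lra.
Qed.

Lemma half_powR_bounds : 0 < q <= 2^-1.
Proof.
rewrite powR_gt0 ?invr_gt0//=; apply: ge1r_powR => //.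
by apply/andP; split; lra.
Qed.

Lemma half_powR_mulr : q * tau = rho.
Proof.
rewrite powRD; last by rewrite pnatr_eq0 implybT.
by rewrite mulrC; congr (_ * _); rewrite -powR_inv1// -powRrM mulN1r.
Qed.

Lemma sqrt_cells_per_sample k n :
  Num.sqrt (((2 ^ k.+1) ^ d)%:R / n%:R) = tau * tau ^+ k * n%:R `^ (- 2^-1).
Proof.
rewrite -powR12_sqrt ?divr_ge0// powRM ?invr_ge0// -exprS.
congr (_ * _).
  rewrite !natrX -exprM mulnC exprM powR_exprn ?exprn_ge0//.
  congr (_ ^+ _); by rewrite -powR_mulrn// -powRrM.
by rewrite -(powR_inv1 (ler0n R n)) -powRrM mulN1r.
Qed.

(** As [v >= 1] gives [q <= 1/2], the powers of [q] sum to at most 2, whence the factor 4 on the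
    prior part. The deviation at level [k.+1] grows like [tau ^+ k] while its cost decays like
    [q ^+ k], so the sum is geometric of ratio [rho = q * tau]. *)
Lemma mean_bound (K n : nat) (S : R) : 0 <= S ->
  q ^+ K + \sum_(k < K) q ^+ k * (2 * S / n%:R +
    Num.sqrt (((2 ^ k.+1) ^ d)%:R / n%:R)) <=
  q ^+ K + 4 * S / n%:R + tau * n%:R `^ (- 2^-1) * \sum_(k < K) rho ^+ k.
Proof.
move=> S0; rewrite -addrA lerD2l.
under eq_bigr do rewrite mulrDr.
rewrite big_split /=; apply: lerD.
  rewrite -mulr_suml.
  have /andP[q0 q2] := half_powR_bounds.
  apply: (@le_trans _ _ (2 * (2 * S / n%:R))).
    apply: ler_wpM2r; first by rewrite !mulr_ge0// invr_ge0.
    apply: le_trans (geometric_sum_le _ _) _.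
      by rewrite ltW//= (le_lt_trans q2)// invf_lt1 ?ltr1n.
    rewrite -[leRHS]invrK lef_pV2 ?posrE ?invr_gt0//; lra.
  by rewrite !mulrA -natrM.
rewrite mulr_sumr; apply: ler_sum => k _; rewrite sqrt_cells_per_sample -half_powR_mulr exprMn.
rewrite le_eqVlt; apply/orP; left; apply/eqP; ring.
Qed.

End rates.

(** * The three regimes of the rate *)

Section rate.
Context {R : realType} (d : nat) (v A : R).
Hypotheses (v1 : 1 <= v) (A0 : 0 < A).
Let v0 : 0 < v. Proof. exact: lt_le_trans v1. Qed.
Local Notation q := (2^-1 `^ v).
Local Notation tau := (2 `^ (d%:R / 2) : R).
Local Notation rho := (2 `^ (d%:R / 2 - v) : R).
Local Notation K n := (K_seq d v n).

Let term (n : nat) (S : R) :=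
  q ^+ K n + 4 * S / n%:R + tau * n%:R `^ (- 2^-1) * \sum_(k < K n) rho ^+ k.

Lemma half_powR_pow_K_seq n : (0 < n)%N -> q ^+ K n <= k_seq d v n `^ (- v).
Proof.
move=> n0; have k0 : 0 < k_seq d v n by apply: lt_le_trans (k_seq_ge1 d v1 n0).
rewrite -powR_exprn ?invr_ge0// -mulN1r powRrM powR_inv1 ?(ltW k0)//.
apply: ge0_ler_powR; rewrite ?nnegrE ?(ltW v0) ?exprn_ge0 ?invr_ge0 ?(ltW k0)//.
have /andP[kK _] := two_pow_K_seq d v1 n0.
by rewrite exprVn lef_pV2 ?posrE// exprn_gt0.
Qed.

Lemma powR_div_natl (n : nat) (u : R) : (0 < n)%N ->
  n%:R `^ u / n%:R = n%:R `^ (u - 1).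
Proof.
move=> n0; rewrite powRB; last by rewrite pnatr_eq0 -lt0n n0 implybT.
by rewrite powRr1.
Qed.

Definition prior_bound (n : nat) : R :=
  if d%:R <= 2 * v then A * n%:R `^ (2^-1) else A * n%:R `^ (1 - v / d%:R).

Definition rate_root (n : nat) : R :=
  if d%:R < 2 * v then n%:R `^ (- (2 * v)^-1)
  else if d%:R == 2 * v then n%:R `^ (- (2 * v)^-1) * (ln n%:R) `^ v^-1
  else n%:R `^ (- (d%:R)^-1).

(** The order of the [v]-th power of the distance; [rate_root] is its [v]-th root, which turns the
    factor [ln n] into [(ln n)^(1/v)]. *)
Definition rate (n : nat) : R :=
  if d%:R < 2 * v then n%:R `^ (- 2^-1)
  else if d%:R == 2 * v then n%:R `^ (- 2^-1) * ln n%:R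
  else n%:R `^ (- (v / d%:R)).

Lemma rate_rootE n : 1 <= ln n%:R :> R -> rate n `^ v^-1 = rate_root n.
Proof.
move=> ln1; have h : - (2 * v)^-1 = - 2^-1 * v^-1 :> R by rewrite invfM mulNr.
rewrite /rate /rate_root; case: ifP => _; first by rewrite h powRrM.
case: ifP => _; last first.
  by rewrite -powRrM mulNr mulrAC divff ?mul1r// gt_eqF.
rewrite powRM ?powR_ge0//; last exact: le_trans ln1.
by rewrite h powRrM.
Qed.

Lemma rate_gt0 n : (0 < n)%N -> 1 <= ln n%:R :> R -> 0 < rate n.
Proof.
move=> n0 ln1; have n0R : 0 < n%:R :> R by rewrite ltr0n.
rewrite /rate; do 2?case: ifP => _; rewrite ?mulr_gt0 ?powR_gt0//.
exact: lt_le_trans ln1.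
Qed.

(** For [d <= 2 * v] the leaf term and the prior term are both of order [n^(-1/2)]; only the
    geometric sum distinguishes [d < 2 * v] from [d = 2 * v]. *)
Lemma term_le_small_dim : d%:R <= 2 * v -> forall n S, (0 < n)%N -> S <= prior_bound n ->
  term n S <= (1 + 4 * A + tau * \sum_(k < K n) rho ^+ k) * n%:R `^ (- 2^-1).
Proof.
move=> dv n S n0; rewrite /prior_bound dv => SA.
rewrite 2!mulrDl mul1r /term [X in _ + X <= _]mulrAC; apply: lerD => //; apply: lerD.
  apply: le_trans (half_powR_pow_K_seq n0) _; rewrite /k_seq dv -powRrM.
  by rewrite mulrN invfM -mulrA mulVf ?mulr1// gt_eqF.
have -> : - 2^-1 = 2^-1 - 1 :> R by lra.
rewrite -powR_div_natl// mulrA ler_pM2r ?invr_gt0 ?ltr0n//.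
by rewrite -mulrA ler_pM2l.
Qed.

Lemma rho_lt1 : d%:R < 2 * v -> rho < 1.
Proof.
move=> dv; rewrite /powR pnatr_eq0 /= expR_lt1 pmulr_llt0; first lra.
by rewrite ln_gt0// ltr1n.
Qed.

Lemma rho_gt1 : 2 * v < d%:R -> 1 < rho.
Proof.
move=> dv; rewrite /powR pnatr_eq0 /= expR_gt1 pmulr_lgt0; first lra.
by rewrite ln_gt0// ltr1n.
Qed.

(** The sign of [d / 2 - v] decides: for [rho < 1] the geometric sum is bounded, for [rho > 1] it is
    of the order of [rho ^+ K], and for [rho = 1] it equals [K], of order [ln n]. *)
Lemma term_le_rate : exists2 C : R, 0 < C &
  forall n S, (0 < n)%N -> 1 <= ln n%:R :> R -> S <= prior_bound n ->
    term n S <= C * rate n.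
Proof.
have tau0 : 0 < tau by rewrite powR_gt0.
have ln20 : 0 < ln 2 :> R by rewrite ln_gt0// ltr1n.
have [dv|dv|dv] := ltrgtP (d%:R : R) (2 * v).
- exists (1 + 4 * A + tau * (1 - rho)^-1) => [|n S n0 _ SA].
    by rewrite !addr_gt0 ?mulr_gt0 ?invr_gt0 ?subr_gt0 ?rho_lt1.
  apply: le_trans (term_le_small_dim (ltW dv) n0 SA) _.
  rewrite /rate dv ler_wpM2r ?powR_ge0// lerD2l ler_pM2l//.
  by apply: geometric_sum_le; rewrite powR_ge0 rho_lt1.
- have dvF : (d%:R <= 2 * v) = false by rewrite leNgt dv.
  have d0 : 0 < d%:R :> R by apply: lt_trans dv; rewrite mulr_gt0.
  exists (1 + 4 * A + tau * (rho / (rho - 1))) => [|n S n0 _ SA].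
    by rewrite !addr_gt0 ?mulr_gt0 ?invr_gt0 ?subr_gt0 ?rho_gt1 ?powR_gt0.
  have n0R : 0 < n%:R :> R by rewrite ltr0n.
  rewrite /rate ltNge (ltW dv) gt_eqF//=.
  rewrite 2!mulrDl mul1r /term; apply: lerD; first apply: lerD.
  + apply: le_trans (half_powR_pow_K_seq n0) _; rewrite /k_seq dvF -powRrM.
    by rewrite mulrN mulrC.
  + have -> : - (v / d%:R) = 1 - v / d%:R - 1 :> R by lra.
    rewrite -powR_div_natl// mulrA ler_pM2r ?invr_gt0//.
    by rewrite -mulrA ler_pM2l//; move: SA; rewrite /prior_bound dvF.
  rewrite -2!mulrA ler_pM2l//.
  have -> : n%:R `^ (- (v / d%:R)) = n%:R `^ (- 2^-1) * n%:R `^ (2^-1 - v / d%:R) :> R.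
    rewrite -powRD; last by rewrite pnatr_eq0 -lt0n n0 implybT.
    by congr (_ `^ _); lra.
  rewrite mulrCA ler_wpM2l ?powR_ge0//.
  apply: le_trans (geometric_sum_gt1 _ (rho_gt1 dv)) _.
  rewrite mulrAC ler_pM2r ?invr_gt0 ?subr_gt0 ?rho_gt1//.
  have e0 : 0 <= d%:R / 2 - v by lra.
  have -> : n%:R `^ (2^-1 - v / d%:R) = (k_seq d v n) `^ (d%:R / 2 - v).
    rewrite /k_seq dvF -powRrM; congr (_ `^ _).
    by field; rewrite gt_eqF.
  have k0 : 0 <= k_seq d v n by apply: le_trans (k_seq_ge1 d v1 n0).
  (* [rho ^+ K] is [2 ^+ K] raised to [d / 2 - v], and [2 ^+ K] is at most twice [k_seq]; this
     factor 2 produces the extra [rho] in the constant. *)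
  rewrite -powR_exprn// -powRM//; apply: ge0_ler_powR => //.
  + by rewrite nnegrE exprn_ge0.
  + by rewrite nnegrE mulr_ge0.
  by have /andP[] := two_pow_K_seq d v1 n0.
(* Here [K] is at most [ln n / (2 v ln 2) + 1], and [1 <= ln n] absorbs the rounding term 1 into
   [c * ln n]. *)
- pose c : R := (2 * v)^-1 / ln 2 + 1.
  have c0 : 0 < c by rewrite addr_gt0// divr_gt0// invr_gt0 mulr_gt0.
  exists (1 + 4 * A + tau * c) => [|n S n0 ln1 SA].
    by rewrite !addr_gt0 ?mulr_gt0.
  have dv' : d%:R <= 2 * v by rewrite dv.
  apply: le_trans (term_le_small_dim dv' n0 SA) _.
  rewrite /rate dv ltxx eqxx [leRHS]mulrCA [leLHS]mulrC ler_wpM2l ?powR_ge0//.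
  have -> : 2 `^ (2 * v / 2 - v) = 1 :> R by rewrite (_ : _ - v = 0) ?powRr0//; lra.
  rewrite (eq_bigr (fun=> 1)) => [|k _]; last by rewrite expr1n.
  rewrite sumr_const card_ord.
  have /andP[_ KE] := K_seq_bounds d v1 n0.
  have Kc : (K n)%:R <= c * ln n%:R.
    apply: le_trans KE _; rewrite /k_seq dv' ln_powR /c [leRHS]mulrDl mul1r.
    by rewrite lerD// mulrAC.
  rewrite [leRHS]mulrDl; apply: lerD.
    by rewrite ler_peMr// addr_ge0// mulr_ge0// ltW.
  by rewrite -[leRHS]mulrA ler_pM2l.
Qed.

End rate.

(** * Combination of the mean bound with the rates *)

Theorem theorem1 (R : realType) (d : nat) (p v : R)
  (hp : 1 <= p) (hv : 1 <= v)
  (dO : measure_display) (Omega : measurableType dO) (P : probability Omega R)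
  (P0 : probability (d.-tuple R) R) (Y : nat -> Omega -> d.-tuple R)
  (hP0 : in_Pd P0) (hY : iid_with_law P Y P0)
  (alpha : forall n : nat, {ffun 'I_d -> 'I_(b_seq d v n)} -> R)
  (A : R) (hA : 0 < A)
  (halpha0 : forall n i, 0 <= alpha n i)
  (halpha : forall n : nat, (0 < n)%N ->
     \sum_(j : {ffun 'I_d -> 'I_(b_seq d v n)}) alpha n j <=
       (if d%:R <= 2 * v then A * n%:R `^ (2^-1)
        else A * n%:R `^ (1 - v / d%:R))) :
  exists C : R, 0 < C /\ exists N : nat, forall n : nat, (N <= n)%N ->
    (\int[P]_(w in [set: Omega])
        wasserstein p v P0 (hist_estimator (alpha n) (fun t => Y t w) n)
     <= (if d%:R < 2 * v then C * n%:R `^ (- (2 * v)^-1)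
         else if d%:R == 2 * v
              then C * n%:R `^ (- (2 * v)^-1) * (ln n%:R) `^ v^-1
         else C * n%:R `^ (- (d%:R)^-1))%:E)%E.
Proof.
have [C C0 HC] := term_le_rate d hv hA.
pose D : R := (d%:R `^ p^-1) `^ v.
have D0 : 0 <= D by exact: powR_ge0.
(* The factor is [D + 1] because [D] vanishes for [d = 0], whereas the bound [B] on the mean has to
   be positive. *)
have C10 : 0 < (D + 1) * C by rewrite mulr_gt0// ltr_wpDl.
exists (2 * ((D + 1) * C) `^ v^-1); split; first by rewrite mulr_gt0// powR_gt0.
(* Any [n] above [e] has [ln n >= 1], which the logarithmic regime uses. *)
exists (Num.truncn (expR 1 : R)).+1 => n Nn.
have n0 : (0 < n)%N by exact: leq_trans Nn.
have ln1 : 1 <= ln n%:R :> R.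
  rewrite -[leLHS](@expRK R) ler_ln ?posrE ?expR_gt0 ?ltr0n//.
  by apply: le_trans (ltW (truncnS_gt _)) _; rewrite ler_nat.
pose B := (D + 1) * C * rate d v n.
have B0 : 0 < B by rewrite mulr_gt0 ?rate_gt0.
pose S := \sum_j alpha n j.
have S0 : 0 <= S by apply: sumr_ge0 => j _; exact: halpha0.
have := @expected_wasserstein R _ _ P d Y P0 hY hP0 p v (K_seq d v n) n (alpha n) B
  hp hv n0 (@halpha0 n) B0.
move=> /(_ _)/le_trans; apply.
  apply: (@le_trans _ _ (D * (C * rate d v n))).
    rewrite ler_wpM2l//; apply: le_trans (mean_bound _ hv _ _ S0) _.
    by apply: HC => //; exact: halpha.
  by rewrite /B -mulrA ler_wpM2r ?lerDl// mulr_ge0 ?ltW ?rate_gt0.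
rewrite lee_fin /B [in leLHS]powRM ?(ltW C10) ?(ltW (rate_gt0 _ _ _ _))// rate_rootE// mulrA /rate_root.
by do 2!case: ifP => _ //; rewrite mulrA.
Qed.
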